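(* Let $\mathbb{F}$ be a field of characteristic $p\ge 2$. Suppose $f\in\mathbb{F}[x_1,\ldots,x_n]$ has degree $\mathrm{poly}(n)$, is computed by an algebraic formula (respectively algebraic branching program) of size $n^{O(\log n)}$, and factors into irreducibles as $f = \prod_i f_i^{p^{e_i} j_i}$ with $p\nmid j_i$. Let $\lambda := \#\{e_i\}$ be the number of distinct values among the $e_i$. Then for each $i$, $f_i^{p^{e_i}}$ can be computed by an algebraic formula (respectively algebraic branching program) over $\overline{\mathbb{F}}_p$ of size $\mathrm{poly}(n^{\lambda\log n})$.
   Context: An algebraic formula is an algebraic circuit (DAG of $+,\times$ gates with variables and field constants at leaves) whose underlying graph is a tree; size is the number of nodes and edges. An algebraic branching program is a layered directed graph with unique source and sink, edges between consecutive layers labelled by affine linear polynomials, computing the sum over source–sink paths of the product of edge labels; size is the number of edges. $\overline{\mathbb{F}}_p$ denotes the algebraic closure of the prime field of characteristic $p$.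
   Formalization: The field F is assumed to embed in the algebraic closure of F_p (so F is algebraic over F_p); without this the claim fails, e.g. f = x_1 + t over F_p(t) is irreducible but has a coefficient outside that closure. *)

(* Defs.v *)
From HB Require Import structures.
From mathcomp Require Import all_boot all_order all_algebra all_field.
From mathcomp Require Import mpoly.

Set Implicit Arguments.
Unset Strict Implicit.
Unset Printing Implicit Defensive.

Import GRing.Theory.
Local Open Scope ring_scope.

(* Gates have unbounded fan-in. A gate without children computes 0 (sum) or
   1 (product) with size 1, exactly as the corresponding constant leaf does. *)
Inductive formula (R : Type) (n : nat) : Type :=
| FVar of 'I_n
| FConst of R
| FAdd of seq (formula R n)
| FMul of seq (formula R n).

Fixpoint formula_eval (R : comNzRingType) (n : nat) (t : formula R n) :
    {mpoly R[n]} :=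
  match t with
  | FVar i => 'X_i
  | FConst c => c%:MP
  | FAdd ts => foldr +%R 0 (map (@formula_eval R n) ts)
  | FMul ts => foldr *%R 1 (map (@formula_eval R n) ts)
  end.

(* Number of nodes plus number of edges: a gate contributes 1 for itself and 1
   for the edge to each of its children. *)
Fixpoint formula_size (R : Type) (n : nat) (t : formula R n) : nat :=
  match t with
  | FVar _ | FConst _ => 1%N
  | FAdd ts | FMul ts =>
      (1 + size ts + sumn (map (@formula_size R n) ts))%N
  end.

(* The layers are numbered 0, ..., abp_depth. The source is the only vertex of
   the first layer and the sink the only vertex of the last one. Labels of
   pairs that are not edges are never used. *)
Record abp (R : comNzRingType) (n : nat) := Abp {
  abp_vertex : finType;
  abp_depth : nat;
  abp_layer : abp_vertex -> nat;
  abp_source : abp_vertex;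
  abp_sink : abp_vertex;
  abp_edge : rel abp_vertex;
  abp_label : abp_vertex -> abp_vertex -> {mpoly R[n]};
  abp_layer_le : forall v, (abp_layer v <= abp_depth)%N;
  abp_sourceP : forall v, abp_layer v = 0%N <-> v = abp_source;
  abp_sinkP : forall v, abp_layer v = abp_depth <-> v = abp_sink;
  abp_edge_layer : forall u v, abp_edge u v -> abp_layer v = (abp_layer u).+1;
  (* msize is the total degree plus one *)
  abp_label_affine : forall u v, abp_edge u v -> (msize (abp_label u v) <= 2)%N
}.

(* By the layering every source-sink path has exactly abp_depth edges; such a
   path is given by the vertices that follow the source. *)
Definition abp_eval (R : comNzRingType) (n : nat) (B : abp R n) :
    {mpoly R[n]} :=
  \sum_(q : (abp_depth B).-tuple (abp_vertex B)
          | path (@abp_edge _ _ B) (abp_source B) q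
            && (last (abp_source B) q == abp_sink B))
    \prod_(a <- pairmap (@abp_label _ _ B) (abp_source B) q) a.

Definition abp_size (R : comNzRingType) (n : nat) (B : abp R n) : nat :=
  #|[set e : abp_vertex B * abp_vertex B | abp_edge e.1 e.2]|.

Definition formula_computable (R : comNzRingType) (n : nat)
    (f : {mpoly R[n]}) (s : nat) : Prop :=
  exists t : formula R n, formula_eval t = f /\ (formula_size t <= s)%N.

Definition abp_computable (R : comNzRingType) (n : nat)
    (f : {mpoly R[n]}) (s : nat) : Prop :=
  exists B : abp R n, abp_eval B = f /\ (abp_size B <= s)%N.

Definition irreducible_elt (R : unitRingType) (x : R) : Prop :=
  [/\ x != 0, x \isn't a GRing.unit &
      forall a b : R, x = a * b ->
        a \is a GRing.unit \/ b \is a GRing.unit].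

Definition associated (R : unitRingType) (x y : R) : Prop :=
  exists2 u : R, u \is a GRing.unit & x = u * y.

(* f = u * \prod_i f_i ^ (p ^ e_i * j_i), with u a nonzero constant and the f_i
   pairwise non-associated irreducibles. *)
Definition irreducible_factorization (F : fieldType) (p n r : nat)
    (f : {mpoly F[n]}) (fs : 'I_r -> {mpoly F[n]}) (e j : 'I_r -> nat) : Prop :=
  [/\ forall i, irreducible_elt (fs i),
      forall i k, associated (fs i) (fs k) -> i = k,
      forall i, ~~ (p %| j i)%N &
      exists2 u : F, u != 0 &
        f = u%:MP * \prod_(i < r) fs i ^+ (p ^ e i * j i)].

Definition num_values (r : nat) (e : 'I_r -> nat) : nat :=
  size (undup (codom e)).

(* K is an algebraic closure of its prime field 'F_p, embedded by phi *)
Definition prime_field_closure (p : nat) (K : closedFieldType)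
    (phi : {rmorphism 'F_p -> K}) : Prop :=
  forall x : K, algebraicOver phi x.

(* The binary logarithm, rounded up *)
Definition log2n (n : nat) : nat := up_log 2 n.

(* Main.v *)
Require Import Defs.
From HB Require Import structures.
From mathcomp Require Import all_boot all_order all_algebra all_field.
From mathcomp Require Import mpoly ring zify.
From Stdlib Require Import Classical_Prop.

Set Implicit Arguments.
Unset Strict Implicit.
Unset Printing Implicit Defensive.

Import GRing.Theory.
Local Open Scope ring_scope.

(* Since F is algebraic over its prime field it is perfect, so each f_i has a
   nonzero partial derivative. Unique factorization in F[x, b][y] then shows
   that on a generic line x + y b the polynomials f_i restrict to univariate
   polynomials of full degree with simple roots and without common roots; these
   properties survive at a suitable point (x, b) over the infinite field K.

   Recentred on such a line, g(x + y b) splits as a product of y - phi_a, with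
   one power series phi_a in x for each root a on the line, so that g is the
   truncation of a constant times the product of the - phi_a. If C = g^m R with
   p not dividing m, then phi_a is a simple root of the Hasse derivative of
   order m - 1 of C(x + y b) in y, so Newton's iteration reaches the required
   precision after O(log D) steps, where D bounds the degree; each step
   multiplies the size by poly(D).

   For general exponents one proceeds by increasing e_i: dividing f by the
   powers already found (a truncated geometric series) leaves a polynomial
   C(x^q) with q = p^(e_i), and the previous argument applies to C with the
   cost of a polynomial h redefined as the cost of h(x^q). This yields
   f_i^q = g(x^q), where g is f_i with its coefficients raised to the power q,
   at the price of one factor D^(O(log D)) for each distinct value of e. *)

(** * Unique factorization in polynomial rings *)

(** Formulas and branching programs enter only through an abstract cost measure: sums and products
    multiply a common bound by a factor linear in the number of operands, and coordinatewise affine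
    substitutions are cheap. Cost is then counted in levels, one level being a factor linear in [D],
    so each Newton step is a fixed number of levels. Genericity comes from Bezout relations
    [c = u f_i + v h] over [F[x, b]] in which [c] is free of [y]: a point where [c] is nonzero keeps
    [f_i] and [h] without common root on the line. A root of multiplicity [m] of [C] is out of reach
    of Newton's iteration. The derivative of the Hasse derivative of order [m - 1] is [m] times the
    one of order [m], which is why [m] must be prime to [p]. The obstacle for larger exponents is
    that computing [C(x^q)] does not compute [C]. But the cost of [h(x^q)] is again a cost measure:
    [v + w x^q] is the [q]-th power of an affine polynomial, [K] having [q]-th roots. Nothing in the
    extraction then needs [C] itself, and the output is a [q]-th power for the same reason. *)

Definition divides (R : idomainType) (a b : R) := exists c, b = c * a.

(** The additive measure [mu], zero only at units among nonzero elements, makes factorization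
    terminate; irreducibles being prime makes it unique. No factorization function or gcd is
    required. *)
Definition ufd (R : idomainType) :=
  (exists mu : R -> nat,
     (forall a b, a != 0 -> b != 0 -> mu (a * b) = (mu a + mu b)%N) /\
     (forall a, a != 0 -> mu a = 0%N -> a \is a GRing.unit)) /\
  (forall x : R, irreducible_elt x ->
     forall a b, divides x (a * b) -> divides x a \/ divides x b).

Section Divides.
Variable R : idomainType.
Implicit Types a b c x : R.

Lemma divides0 a : divides a 0.
Proof. by exists 0; rewrite mul0r. Qed.

Lemma divides_refl a : divides a a.
Proof. by exists 1; rewrite mul1r. Qed.

Lemma dividesD a b c : divides a b -> divides a c -> divides a (b + c).
Proof. by move=> [u ->] [v ->]; exists (u + v); rewrite mulrDl. Qed.

Lemma dividesB a b c : divides a b -> divides a c -> divides a (b - c).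
Proof. by move=> [u ->] [v ->]; exists (u - v); rewrite mulrBl. Qed.

Lemma divides_mull a b c : divides a b -> divides a (c * b).
Proof. by move=> [u ->]; exists (c * u); rewrite mulrA. Qed.

Lemma divides_mulr a b c : divides a b -> divides a (b * c).
Proof. by rewrite mulrC; apply: divides_mull. Qed.

Lemma divides_trans b a c : divides a b -> divides b c -> divides a c.
Proof. by move=> [u ->] [v ->]; exists (v * u); rewrite mulrA. Qed.

Hypothesis R_ufd : ufd R.

(** Splitting off an irreducible factor lowers [mu]. Irreducibility is not decidable here, so the
    search for a factor uses excluded middle. *)
Lemma ufd_ind (P : R -> Prop) :
  (forall a, a \is a GRing.unit -> P a) ->
  (forall x a, irreducible_elt x -> a != 0 -> P a -> P (x * a)) ->
  forall a, a != 0 -> P a.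
Proof.
have [[mu [muM mu0]] _] := R_ufd => Punit Pmul.
have irr_div a : a != 0 -> a \isn't a GRing.unit ->
    exists x b, irreducible_elt x /\ a = x * b.
  have [k] := ubnP (mu a); elim: k a => // k IH a lek nza nua.
  have [irra|nirra] := classic (irreducible_elt a).
    by exists a, 1; rewrite mulr1.
  have [b [c [def_a nub nuc]]] : exists b c,
      [/\ a = b * c, b \isn't a GRing.unit & c \isn't a GRing.unit].
    apply: NNPP => no_bc; apply: nirra; split=> // b c def_a.
    have [ub|nub] := boolP (b \is a GRing.unit); first by left.
    have [uc|nuc] := boolP (c \is a GRing.unit); first by right.
    by case: no_bc; exists b, c.
  have [nzb nzc] : b != 0 /\ c != 0.
    by apply/andP; rewrite -negb_or -mulf_eq0 -def_a.
  have mub : (mu b < mu a)%N.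
    rewrite def_a muM // -[ltnLHS]addn0 ltn_add2l lt0n.
    by apply: contraNneq nuc => /(mu0 _ nzc).
  have [|||x [d [irrx def_b]]] := IH b => //.
    by apply: leq_trans mub _; rewrite -ltnS.
  by exists x, (d * c); rewrite mulrA -def_b.
move=> a; have [k] := ubnP (mu a); elim: k a => // k IH a lek nza.
have [/Punit//|nua] := boolP (a \is a GRing.unit).
have [x [b [irrx def_a]]] := irr_div a nza nua.
have [nzx nzb] : x != 0 /\ b != 0.
  by apply/andP; rewrite -negb_or -mulf_eq0 -def_a.
rewrite def_a; apply: Pmul => //; apply: IH => //.
rewrite -ltnS; apply: leq_trans lek; rewrite ltnS def_a muM //.
rewrite -[ltnLHS]add0n ltn_add2r lt0n; have [_ nux _] := irrx.
by apply: contraNneq nux => /(mu0 _ nzx).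
Qed.

End Divides.

Lemma ufd_iso (A B : idomainType) (phi : {rmorphism A -> B})
    (psi : {rmorphism B -> A}) :
  cancel phi psi -> cancel psi phi -> ufd A -> ufd B.
Proof.
move=> phiK psiK [[mu [muM mu0]] primeA].
have nzpsi b : (psi b != 0) = (b != 0).
  by rewrite -(inj_eq (can_inj psiK)) rmorph0.
have unit_psi b : (psi b \is a GRing.unit) = (b \is a GRing.unit).
  apply/idP/idP => [/(rmorph_unit phi)|/(rmorph_unit psi)//].
  by rewrite psiK.
split.
  exists (mu \o psi); split=> [a b nza nzb|a nza] /=.
    by rewrite rmorphM muM ?nzpsi.
  by move=> /mu0; rewrite nzpsi unit_psi; apply.
move=> x [nzx nux irrx] a b [c def_ab].
have irrx' : irreducible_elt (psi x).
  split=> [||u v /(congr1 phi)]; rewrite ?nzpsi ?unit_psi //.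
  by rewrite psiK rmorphM => /irrx []; rewrite -unit_psi phiK; [left|right].
have [|[u def_u]|[u def_u]] := primeA _ irrx' (psi a) (psi b).
- by exists (psi c); rewrite -!rmorphM def_ab.
- by left; exists (phi u); rewrite -[LHS]psiK def_u rmorphM psiK.
- by right; exists (phi u); rewrite -[LHS]psiK def_u rmorphM psiK.
Qed.

Lemma field_ufd (F : fieldType) : ufd F.
Proof.
split; first by exists (fun=> 0%N); split=> // a nza _; rewrite unitfE.
by move=> x [nzx]; rewrite unitfE nzx.
Qed.

(** * Gauss's lemma and unique factorization in [R[X]] *)

Section PolyUfd.
Variable R : idomainType.
Hypothesis R_ufd : ufd R.
Implicit Types (f g h : {poly R}) (x c : R).

Let prime_of x : irreducible_elt x ->
  forall a b, divides x (a * b) -> divides x a \/ divides x b.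
Proof. by case: R_ufd => _; apply. Qed.

Lemma dividesPX x g : divides x%:P (g * 'X) -> divides x%:P g.
Proof.
move=> [u def_gX]; have nz : u`_0 * x = 0.
  by rewrite -coefMC -def_gX coefMX.
exists (\poly_(i < size u) u`_i.+1).
apply/polyP=> i; rewrite coefMC coef_poly.
have -> : g`_i = (u * x%:P)`_i.+1 by rewrite -def_gX coefMX.
rewrite coefMC; case: ltnP => // le_ui; rewrite nth_default //.
exact: leq_trans le_ui _.
Qed.

(** Induction on the sum of the sizes: [x] divides the product of the constant terms, hence one of
    them; that term is removed and the rest divided by ['X]. *)
Lemma polyC_prime x : irreducible_elt x ->
  forall g h, divides x%:P (g * h) -> divides x%:P g \/ divides x%:P h.
Proof.
move=> irrx g h; have [k] := ubnP (size g + size h).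
elim: k g h => // k IH g h lek div_gh.
have [->|nzg] := eqVneq g 0; first by left; apply: divides0.
have [->|nzh] := eqVneq h 0; first by right; apply: divides0.
have split_poly f : f != 0 ->
    exists q, [/\ f = q * 'X + (f`_0)%:P & (size q < size f)%N].
  elim/poly_ind: f => [|q c _]; first by rewrite eqxx.
  move=> nzf; exists q; rewrite coefD coefMX coefC eqxx add0r.
  rewrite size_MXaddC; case: ifP => [/andP[/eqP q0 /eqP c0]|] //.
  by rewrite q0 c0 mul0r addr0 eqxx in nzf.
have [g' [def_g szg]] := split_poly g nzg.
have [h' [def_h szh]] := split_poly h nzh.
have := div_gh; rewrite {1}def_g {1}def_h => -[u].
move=> /(congr1 (fun f : {poly R} => f`_0)).
rewrite coefMC coef0M !coefD !coefMX !coefC eqxx !add0r.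
move=> eq0; have [//|[c def_c]|[c def_c]] := prime_of irrx (a := g`_0) (b := h`_0).
- by exists u`_0.
- have : divides x%:P (g' * h).
    apply: dividesPX; rewrite mulrAC.
    have -> : g' * 'X * h = g * h - (c * x)%:P * h.
      by rewrite -mulrBl; congr (_ * _); rewrite [in RHS]def_g def_c addrK.
    apply: dividesB => //; apply: divides_mulr; exists c%:P.
    by rewrite polyCM.
  have lt_k : (size g' + size h < k)%N.
    by rewrite -ltnS; apply: leq_trans lek; rewrite ltnS ltn_add2r.
  case/(IH _ _ lt_k) => [div_g'|]; [left|by right]; rewrite def_g def_c; apply: dividesD.
    exact: divides_mulr.
  by exists c%:P; rewrite polyCM.
- have : divides x%:P (g * h').
    apply: dividesPX; rewrite -mulrA.
    have -> : g * (h' * 'X) = g * h - g * (c * x)%:P.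
      by rewrite -mulrBr; congr (_ * _); rewrite [in RHS]def_h def_c addrK.
    apply: dividesB => //; apply: divides_mull; exists c%:P.
    by rewrite polyCM.
  have lt_k : (size g + size h' < k)%N.
    by rewrite -ltnS; apply: leq_trans lek; rewrite ltnS ltn_add2l.
  case/(IH _ _ lt_k) => [|div_h']; [by left|right]; rewrite def_h def_c; apply: dividesD.
    exact: divides_mulr.
  by exists c%:P; rewrite polyCM.
Qed.

(** Replaces the usual condition on the content, so that no gcd in [R] has to exist. *)
Definition primitive f := forall x, irreducible_elt x -> ~ divides x%:P f.

(** The irreducible factors of [c] are cancelled one at a time: by Gauss's lemma each divides the
    cofactor, since it cannot divide [f]. *)
Lemma primitive_divides f c g : primitive f -> c != 0 ->
  divides f (c%:P * g) -> divides f g.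
Proof.
move=> prim_f nzc; move: c nzc g.
apply: (ufd_ind R_ufd) => [a ua g [u def_ag]|x a irrx nza IH g [u def_g]].
  exists (a^-1%:P * u); rewrite -mulrA -def_ag mulrA -polyCM mulVr //.
  by rewrite mul1r.
have [|[v def_u]|/(prim_f _ irrx)//] := @polyC_prime x irrx u f.
  by exists (a%:P * g); rewrite -def_g polyCM -mulrA mulrC.
apply: IH; exists v; have nzx : x%:P != 0 by rewrite polyC_eq0; case: irrx.
apply: (mulfI nzx); rewrite [LHS]mulrA -polyCM def_g def_u.
by rewrite mulrAC mulrC mulrA.
Qed.

Lemma primitive_part f : f != 0 ->
  exists c g, [/\ c != 0, primitive g & f = c%:P * g].
Proof.
have [[mu [muM mu0]] _] := R_ufd.
have [k] := ubnP (mu (lead_coef f)); elim: k f => // k IH f lek nzf.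
have [prim_f|nprim] := classic (primitive f).
  by exists 1, f; split; rewrite ?oner_eq0 ?mul1r.
have [x [irrx [g def_f]]] : exists x, irreducible_elt x /\ divides x%:P f.
  apply: NNPP => no_x; apply: nprim => x irrx divx.
  by apply: no_x; exists x.
have [nzx nux _] := irrx.
have nzg : g != 0 by apply: contraNneq nzf => g0; rewrite def_f g0 mul0r.
have [||c [h [nzc prim_h def_g]]] := IH g => //.
  rewrite -ltnS; apply: leq_trans lek; rewrite ltnS def_f lead_coefM lead_coefC.
  rewrite muM ?lead_coef_eq0 // -[ltnLHS]addn0 ltn_add2l lt0n.
  by apply: contraNneq nux => /(mu0 _ nzx).
exists (c * x), h; split; rewrite ?mulf_neq0 // def_f def_g.
by rewrite polyCM mulrAC.
Qed.

Lemma irreducible_primitive f :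
  irreducible_elt f -> (1 < size f)%N -> primitive f.
Proof.
move=> [nzf nuf irrf] szf x [nzx nux _] [u def_f].
have [uu|] := irrf _ _ def_f; last by rewrite poly_unitE coefC (negPf nux) andbF.
move: uu szf; rewrite def_f poly_unitE mulrC mul_polyC size_scale //.
by case/andP=> /eqP->.
Qed.

(** The constant is the resultant, which lies in the ideal of [f] and [g]. Were it zero, the gcd
    over the fraction field would be nonconstant; its primitive part would divide both in [R[X]],
    hence be associated to the irreducible [f], and [f] would divide [g]. *)
Lemma irreducible_bezout f g :
  irreducible_elt f -> (1 < size f)%N -> ~ divides f g ->
  exists c u v, c != 0 /\ c%:P = u * f + v * g.
Proof.
move=> irrf szf ndiv; have [szg|szg] := leqP (size g) 1.
  have nzg : g != 0 by apply: contra_notN ndiv => /eqP->; apply: divides0.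
  exists g`_0, 0, 1; rewrite mul0r mul1r add0r -size1_polyC //; split=> //.
  by apply: contraNneq nzg => g0; rewrite (size1_polyC szg) g0.
have [[u v] /= _ def_res] := resultant_in_ideal szf szg.
exists (resultant f g), u, v; split=> //.
rewrite resultant_eq0; apply: contra_notN ndiv => szd.
set d := gcdp f g in szd *.
have nzd : d != 0 by rewrite -size_poly_gt0 (ltn_trans _ szd).
have [c [h [nzc prim_h def_d]]] := primitive_part nzd.
have div_of k : d %| k -> divides h k.
  case/Pdiv.Idomain.dvdpP => -[a w] /= nza def_k.
  apply: (primitive_divides prim_h nza); rewrite mul_polyC def_k def_d.
  by exists (w * c%:P); rewrite mulrA.
have [w def_f] := div_of f (dvdp_gcdl _ _).
have [_ _ /(_ _ _ def_f) [uw|uh]] := irrf; last first.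
  move: szd uh; rewrite def_d mul_polyC size_scale // poly_unitE.
  by case: (size h) => [|[]].
apply: divides_trans (div_of g (dvdp_gcdr _ _)).
by exists w^-1; rewrite def_f mulKr.
Qed.

(** The measure is the degree plus the measure of the leading coefficient. Constant irreducibles are
    prime by Gauss's lemma. For a nonconstant [f] not dividing [g], a Bezout relation shows that [f]
    divides [c h] with [c] constant, and [f] is primitive. *)
Lemma poly_ufd : ufd {poly R}.
Proof.
have [[mu [muM mu0]] primeR] := R_ufd; split.
  exists (fun f => ((size f).-1 + mu (lead_coef f))%N); split=> [f g nzf nzg|f nzf].
    rewrite lead_coefM muM ?lead_coef_eq0 // addnACA; congr (_ + _)%N.
    rewrite size_mul //; move: nzf nzg; rewrite -!size_poly_gt0.
    by case: (size f) => // k; case: (size g) => //= l; rewrite addnS.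
  move/eqP; rewrite addn_eq0 => /andP[/eqP szf /eqP mul].
  have szf1 : size f = 1%N.
    by move: szf nzf; rewrite -size_poly_gt0; case: (size f) => //= k ->.
  rewrite poly_unitE szf1 eqxx /=; have := mul.
  rewrite lead_coefE szf1 => /mu0; apply.
  by have := nzf; rewrite -lead_coef_eq0 lead_coefE szf1.
move=> f irrf g h div_gh; have [nzf nuf irr_f] := irrf.
have [szf|szf] := leqP (size f) 1.
  have def_f := size1_polyC szf; set x := f`_0 in def_f.
  have irrx : irreducible_elt x.
    split=> [||a b def_x]; first by rewrite -polyC_eq0 -def_f.
      by apply: contra nuf => ux; rewrite def_f; apply: (rmorph_unit polyC).
    have [||] := irr_f a%:P b%:P; first by rewrite -polyCM -def_x.
      by rewrite poly_unitE coefC => /andP[_]; left.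
    by rewrite poly_unitE coefC => /andP[_]; right.
  by rewrite def_f in div_gh *; apply: polyC_prime.
have prim_f := irreducible_primitive irrf szf.
have [|ndiv] := classic (divides f g); [by left|right].
have [c [u [v [nzc def_c]]]] := irreducible_bezout irrf szf ndiv.
apply: (primitive_divides prim_f nzc); rewrite def_c mulrDl; apply: dividesD.
  by apply: divides_mulr; apply: divides_mull; apply: divides_refl.
by rewrite -mulrA; apply: divides_mull.
Qed.

End PolyUfd.

(** * Multivariate polynomials *)

Lemma mpoly_gen_ind (R : nzRingType) (n : nat) (P : {mpoly R[n]} -> Prop) :
  (forall c, P c%:MP) -> (forall i, P 'X_i) ->
  (forall f g, P f -> P g -> P (f + g)) ->
  (forall f g, P f -> P g -> P (f * g)) -> forall f, P f.
Proof.
move=> PC PX PD PM; elim/mpolyind => [|c m f _ _ Pf].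
  by rewrite -mpolyC0; apply: PC.
apply: PD => //; rewrite -mul_mpolyC; apply: (PM) => //.
rewrite mpolyXE_id; elim/big_ind: _ => [|g h|i _]; [by rewrite -mpolyC1 | exact: (PM) |].
by elim: (m i) => [|k IH]; rewrite ?expr0 -?mpolyC1 // exprS; apply: PM.
Qed.

Lemma mpoly_rmorph_ext (R : comNzRingType) (S : nzRingType) (n : nat)
    (phi psi : {rmorphism {mpoly R[n]} -> S}) :
  (forall c, phi c%:MP = psi c%:MP) -> (forall i, phi 'X_i = psi 'X_i) ->
  phi =1 psi.
Proof.
move=> eqC eqX; elim/mpoly_gen_ind => // f g eqf eqg.
  by rewrite !rmorphD eqf eqg.
by rewrite !rmorphM eqf eqg.
Qed.

Lemma poly_rmorph_ext (R : nzRingType) (S : nzRingType)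
    (phi psi : {rmorphism {poly R} -> S}) :
  (forall c, phi c%:P = psi c%:P) -> phi 'X = psi 'X -> phi =1 psi.
Proof.
move=> eqC eqX; elim/poly_ind => [|f c eqf]; first by rewrite !rmorph0.
by rewrite !rmorphD !rmorphM eqf eqX eqC.
Qed.

Lemma mmapXU (R : nzRingType) (S : comNzRingType) (n : nat)
    (f : {rmorphism R -> S}) (h : 'I_n -> S) i : mmap f h 'X_i = h i.
Proof. by rewrite mmapX mmap1U. Qed.

Lemma mpoly_unitP (F : fieldType) (n : nat) (f : {mpoly F[n]}) :
  reflect (exists2 c, c != 0 & f = c%:MP) (f \is a GRing.unit).
Proof.
apply: (iffP andP) => [[/eqP def_f uc]|[c nzc ->]].
  by exists f@_0%MM; rewrite // -unitfE.
by rewrite mcoeffC eqxx mulr1 unitfE.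
Qed.

(** * Isolating the last variable *)

Section LastVariable.
Variables (R : comNzRingType) (n : nat).

Definition mpoly_to_poly : {mpoly R[n.+1]} -> {poly {mpoly R[n]}} :=
  mmap (polyC \o @mpolyC n R)
    (fun i => oapp (fun j => ('X_j)%:P) 'X (unlift ord_max i)).

HB.instance Definition _ := GRing.RMorphism.on mpoly_to_poly.

Definition mpoly_lift : {mpoly R[n]} -> {mpoly R[n.+1]} :=
  mmap (@mpolyC n.+1 R) (fun j => 'X_(lift ord_max j)).

HB.instance Definition _ := GRing.RMorphism.on mpoly_lift.

Definition poly_to_mpoly : {poly {mpoly R[n]}} -> {mpoly R[n.+1]} :=
  horner_eval 'X_ord_max \o map_poly mpoly_lift.

HB.instance Definition _ := GRing.RMorphism.on poly_to_mpoly.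

Lemma poly_to_mpolyC c : poly_to_mpoly c%:P = mpoly_lift c.
Proof. by rewrite /poly_to_mpoly /= map_polyC /horner_eval hornerC. Qed.

Lemma poly_to_mpolyX : poly_to_mpoly 'X = 'X_ord_max.
Proof. by rewrite /poly_to_mpoly /= map_polyX /horner_eval hornerX. Qed.

Lemma mpoly_to_polyK : cancel mpoly_to_poly poly_to_mpoly.
Proof.
apply: (@mpoly_rmorph_ext _ _ _ (poly_to_mpoly \o mpoly_to_poly) idfun) => [c|i] /=.
  by rewrite /mpoly_to_poly mmapC poly_to_mpolyC /mpoly_lift mmapC.
rewrite /mpoly_to_poly mmapXU; case: unliftP => [j ->|->] /=.
  by rewrite poly_to_mpolyC /mpoly_lift mmapXU.
exact: poly_to_mpolyX.
Qed.

Lemma poly_to_mpolyK : cancel poly_to_mpoly mpoly_to_poly.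
Proof.
apply: (@poly_rmorph_ext _ _ (mpoly_to_poly \o poly_to_mpoly) idfun) => [c|] /=.
  rewrite poly_to_mpolyC.
  apply: (@mpoly_rmorph_ext _ _ _ (mpoly_to_poly \o mpoly_lift) polyC) => [d|i] /=.
    by rewrite /mpoly_lift mmapC /mpoly_to_poly mmapC.
  by rewrite /mpoly_lift mmapXU /mpoly_to_poly mmapXU liftK.
by rewrite poly_to_mpolyX /mpoly_to_poly mmapXU unlift_none.
Qed.

End LastVariable.

Lemma mpoly_ufd (F : fieldType) (n : nat) : ufd {mpoly F[n]}.
Proof.
elim: n => [|n IH].
  apply: (ufd_iso (phi := @mpolyC 0 F) (psi := mcoeff 0%MM)) (field_ufd F).
    exact: mpolyCK.
  exact: mpolyKC.
apply: ufd_iso (@poly_to_mpolyK F n) (@mpoly_to_polyK F n) _.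
exact: poly_ufd.
Qed.

(** * Points where a nonzero polynomial does not vanish *)

Lemma closed_field_fresh (K : closedFieldType) (s : seq K) :
  exists x, x \notin s.
Proof.
(* This polynomial equals 1 on [s]; the extra factor ['X] keeps it nonconstant when [s] is empty. *)
pose P := \prod_(z <- s) ('X - z%:P) * 'X + 1.
have szP : size P = (size s).+2.
  have nzQ := monic_neq0 (monic_prod_XsubC s xpredT id).
  have szQ : size (\prod_(z <- s) ('X - z%:P) * 'X) = (size s).+2.
    by rewrite size_mulX // size_prod_XsubC.
  by rewrite /P size_addl szQ // size_poly1.
have [x /eqP Px] : exists x, root P x.
  by apply/closed_rootP; rewrite szP.
exists x; apply/negP => xs; move/eqP: Px; rewrite /P !hornerE horner_prod.
rewrite (big_rem x) //= !hornerE subrr !mul0r add0r.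
by rewrite oner_eq0.
Qed.

Lemma closed_field_points (K : closedFieldType) (N : nat) :
  exists2 s : seq K, size s = N & uniq s.
Proof.
elim: N => [|N [s szs us]]; first by exists [::].
have [x xs] := closed_field_fresh s.
by exists (x :: s); rewrite /= ?szs // xs.
Qed.

Lemma poly_nonroot (K : closedFieldType) (f : {poly K}) :
  f != 0 -> exists x, f.[x] != 0.
Proof.
move=> nzf; have [s szs us] := closed_field_points K (size f).
have [/allP all_roots|] := boolP (all (root f) s).
  have := max_poly_roots nzf (introT allP all_roots) us.
  by rewrite szs ltnn.
by case/allPn => x _; rewrite rootE; exists x.
Qed.

Lemma mpoly_nonroot (K : closedFieldType) (n : nat) (f : {mpoly K[n]}) :
  f != 0 -> exists v, f.@[v] != 0.
Proof.
elim: n f => [|n IH] f nzf.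
  exists (fun=> 0); rewrite (nvar0_mpolyC f) mevalC.
  by rewrite -(mpolyC_eq0 0) -nvar0_mpolyC.
pose P := mpoly_to_poly f.
have nzP : P != 0.
  by apply: contraNneq nzf => P0; rewrite -(mpoly_to_polyK f) -/P P0 rmorph0.
have [v nzv] := IH _ (etrans (congr1 negb (lead_coef_eq0 P)) nzP).
pose Q := map_poly (meval v) P.
have nzQ : Q != 0.
  apply: contraNneq nzv => Q0; rewrite lead_coefE -coef_map.
  by rewrite -/Q Q0 coef0.
have [x nzx] := poly_nonroot nzQ.
exists (fun i => oapp v x (unlift ord_max i)); apply: contraNneq nzx => fv.
rewrite /Q; apply/eqP; rewrite -{}fv.
apply: (@mpoly_rmorph_ext _ _ _
  (horner_eval x \o map_poly (meval v) \o @mpoly_to_poly K n) (meval _)) => [c|i] /=.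
  by rewrite /mpoly_to_poly mmapC /= map_polyC /= /horner_eval hornerC !mevalC.
rewrite /mpoly_to_poly mmapXU mevalXU; case: unliftP => [j _|_] /=.
  by rewrite map_polyC /= /horner_eval hornerC mevalXU.
by rewrite map_polyX /horner_eval hornerX.
Qed.

(** * Restriction to a line *)

Section Line.
Variables (R S : comNzRingType) (n : nat) (phi : {rmorphism R -> S}).
Variables (a b : 'I_n -> S).

(** The coefficients move along [phi] and the point and direction live in [S], so one definition
    covers lines over [K], the generic line with indeterminate point and direction, and the
    homogenization [f(T x)]. *)
Definition line : {mpoly R[n]} -> {poly S} :=
  mmap (polyC \o phi) (fun j => (a j)%:P + (b j)%:P * 'X).

HB.instance Definition _ := GRing.RMorphism.on line.

Lemma lineC c : line c%:MP = (phi c)%:P.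
Proof. by rewrite /line mmapC. Qed.

Lemma lineX j : line 'X_j = (a j)%:P + (b j)%:P * 'X.
Proof. by rewrite /line mmapXU. Qed.

Lemma size_line_mmap1 m :
  (size (mmap1 (fun j => ((a j)%:P + (b j)%:P * 'X)%R) m) <= (mdeg m).+1)%N.
Proof.
have lin j : (size ((a j)%:P + (b j)%:P * 'X)%R <= 2)%N.
  by rewrite addrC size_MXaddC; case: ifP => //; rewrite ltnS size_polyC_leq1.
have sizeM (f g : {poly S}) d e : (size f <= d.+1 -> size g <= e.+1 ->
    size (f * g)%R <= (d + e).+1)%N.
  move=> lef leg; apply: leq_trans (size_polyMleq _ _) _.
  rewrite -ltnS; case: (size f + size g)%N (leq_add lef leg) => //= k.
  by rewrite addnS addSn ltnS.
rewrite /mmap1 mdegE; elim/big_rec2: _ => [|j d f _ lef].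
  by rewrite size_poly1.
apply: (sizeM) lef; elim: (m j) => [|k IH]; first by rewrite size_poly1.
by rewrite exprS -(add1n k); apply: sizeM.
Qed.

Lemma size_line f : (size (line f) <= msize f)%N.
Proof.
rewrite /line /mmap; elim/big_ind: _ => [|g h leg leh|m _].
- by rewrite size_poly0.
- by apply: leq_trans (size_polyD _ _) _; rewrite geq_max leg.
have [suppm|] := boolP (m \in msupp f); last first.
  by move/memN_msupp_eq0=> ->; rewrite /= !rmorph0 mul0r size_poly0.
apply: leq_trans (msize_mdeg_lt suppm); rewrite /= mul_polyC.
exact: leq_trans (size_scale_leq _ _) (size_line_mmap1 _).
Qed.

Lemma horner_line f t : (line f).[t] = mmap phi (fun j => a j + b j * t) f.
Proof.
apply: (@mpoly_rmorph_ext _ _ _ (horner_eval t \o line)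
          (mmap phi (fun j => a j + b j * t))) => [c|j] /=.
  by rewrite lineC /horner_eval hornerC mmapC.
by rewrite lineX /horner_eval !hornerE mmapXU.
Qed.

End Line.

Lemma map_line (R S T : comNzRingType) n (phi : {rmorphism R -> S})
    (psi : {rmorphism S -> T}) (chi : {rmorphism R -> T})
    (a b : 'I_n -> S) (a' b' : 'I_n -> T) f :
  (forall c, psi (phi c) = chi c) ->
  (forall j, psi (a j) = a' j) -> (forall j, psi (b j) = b' j) ->
  map_poly psi (line phi a b f) = line chi a' b' f.
Proof.
move=> eqC eqa eqb.
apply: (@mpoly_rmorph_ext _ _ _ (map_poly psi \o line phi a b)
          (line chi a' b')) => [c|j] /=.
  by rewrite !lineC map_polyC /= eqC.
by rewrite !lineX rmorphD rmorphM /= !map_polyC map_polyX /= eqa eqb.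
Qed.

Lemma mmap_ext (R S : comNzRingType) n (phi psi : {rmorphism R -> S})
    (a b : 'I_n -> S) f :
  phi =1 psi -> a =1 b -> mmap phi a f = mmap psi b f.
Proof.
move=> eqp eqa.
apply: (@mpoly_rmorph_ext _ _ _ (mmap phi a) (mmap psi b)) => [c|j] /=.
  by rewrite !mmapC; apply: eqp.
by rewrite !mmapXU eqa.
Qed.

Lemma mmap_idX (R : comNzRingType) n (f : {mpoly R[n]}) :
  mmap (@mpolyC n R) (fun j => 'X_j) f = f.
Proof.
apply: (@mpoly_rmorph_ext _ _ _ (mmap (@mpolyC n R) _) idfun) => [c|j].
  exact: mmapC.
exact: mmapXU.
Qed.

(** * Bounds on the total degree *)

Section Degree.
Variables (R : idomainType) (n : nat).
Implicit Types f g : {mpoly R[n]}.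

Lemma msizeM_leq f g d e :
  (msize f <= d.+1 -> msize g <= e.+1 -> msize (f * g)%R <= (d + e).+1)%N.
Proof.
move=> lef leg; have [->|nzf] := eqVneq f 0; first by rewrite mul0r msize0.
have [->|nzg] := eqVneq g 0; first by rewrite mulr0 msize0.
rewrite msizeM //; rewrite -ltnS.
case: (msize f + msize g)%N (leq_add lef leg) => //= k.
by rewrite addnS addSn ltnS.
Qed.

Lemma msize_prod_leq (I : Type) (r : seq I) (P : pred I) (F : I -> {mpoly R[n]})
    (d : I -> nat) :
  (forall i, P i -> msize (F i) <= (d i).+1)%N ->
  (msize (\prod_(i <- r | P i) F i)%R <= (\sum_(i <- r | P i) d i).+1)%N.
Proof.
move=> le_d; elim/big_rec2: _ => [|i e f Pi lef]; first by rewrite msize1.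
exact: msizeM_leq (le_d i Pi) lef.
Qed.

Lemma msizeX_leq f d k : (msize f <= d.+1 -> msize (f ^+ k)%R <= (d * k).+1)%N.
Proof.
move=> lef; elim: k => [|k IH]; first by rewrite expr0 msize1.
by rewrite exprS mulnS; apply: msizeM_leq.
Qed.

Lemma msize_sum_leq (I : Type) (r : seq I) (P : pred I) (F : I -> {mpoly R[n]}) d :
  (forall i, P i -> msize (F i) <= d)%N ->
  (msize (\sum_(i <- r | P i) F i)%R <= d)%N.
Proof.
move=> le_d; elim/big_ind: _ => [|f g lef leg|i /le_d//]; first by rewrite msize0.
by apply: leq_trans (msizeD_le _ _) _; rewrite geq_max lef.
Qed.

Lemma msize_subst_affine (k : nat) (h : 'I_k -> {mpoly R[n]}) (f : {mpoly R[k]}) :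
  (forall i, msize (h i) <= 2)%N ->
  (msize (mmap (@mpolyC n R) h f) <= msize f)%N.
Proof.
move=> le_h; rewrite /mmap big_seq; apply: msize_sum_leq => m suppm.
apply: leq_trans (msize_mdeg_lt suppm); rewrite mul_mpolyC.
apply: leq_trans (msizeZ_le _ _) _; rewrite /mmap1 mdegE.
apply: msize_prod_leq => i _; rewrite -[X in (_ <= X.+1)%N]mul1n.
exact: msizeX_leq.
Qed.

End Degree.

(* [sigma f] is f(T x): its coefficient of T^k is the homogeneous component of
   degree k of f. *)
Definition sigma (R : comNzRingType) n : {mpoly R[n]} -> {poly {mpoly R[n]}} :=
  line (@mpolyC n R) (fun=> 0) (fun j => 'X_j).

HB.instance Definition _ (R : comNzRingType) n :=
  GRing.RMorphism.on (@sigma R n).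

Lemma coef_sigma (R : comNzRingType) n (f : {mpoly R[n]}) k m :
  (sigma f)`_k@_m = if mdeg m == k then f@_m else 0.
Proof.
have sigmaX m' : sigma 'X_[m'] = 'X_[R, m']%:P * 'X^(mdeg m').
  rewrite /sigma /line mmapX /mmap1 mdegE -prodrXr mpolyXE_id rmorph_prod /=.
  rewrite -big_split /=; apply: eq_bigr => j _.
  by rewrite add0r exprMn rmorphXn.
rewrite [in LHS](mpolyE f) rmorph_sum /= coef_sum raddf_sum /=.
under eq_bigr => m' _.
  rewrite -mul_mpolyC rmorphM /= sigmaX {1}/sigma lineC mulrA -rmorphM /=.
  rewrite mul_mpolyC coefCM coefXn mulr_natr mcoeffMn mcoeffZ mcoeffX.
  over.
have [suppm|nsupp] := boolP (m \in msupp f); last first.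
  rewrite (memN_msupp_eq0 nsupp) if_same big_seq big1 // => m' suppm'.
  case: (eqVneq m' m) suppm' nsupp => [->->//|_ _ _].
  by rewrite mulr0 mul0rn.
rewrite (bigD1_seq m) ?msupp_uniq //= big1 ?addr0 => [|m' /negPf->]; last first.
  by rewrite mulr0 mul0rn.
by rewrite eqxx mulr1 eq_sym; case: eqP.
Qed.

Lemma size_sigma (R : comNzRingType) n (f : {mpoly R[n]}) :
  size (sigma f) = msize f.
Proof.
apply/eqP; rewrite eqn_leq size_line /=.
have [->|nzf] := eqVneq f 0; first by rewrite msize0.
rewrite -mlead_deg //; apply: contraTltn (mlead_supp nzf) => szf.
rewrite -mcoeff_eq0 -[f@__]/(if true then f@_(mlead f) else 0).
by rewrite -(eqxx (mdeg (mlead f))) -coef_sigma nth_default // mcoeff0.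
Qed.

Lemma sigma_horner1 (R : comNzRingType) n (f : {mpoly R[n]}) :
  (sigma f).[1] = f.
Proof.
rewrite horner_line -[RHS]mmap_idX; apply: mmap_ext => // j.
by rewrite add0r mulr1.
Qed.

(** * A generic line *)

Lemma irreducible_msize (F : fieldType) n (f : {mpoly F[n]}) :
  irreducible_elt f -> (1 < msize f)%N.
Proof.
move=> [nzf nuf _]; rewrite ltnNge; apply: contra nuf => /msize1_polyC def_f.
apply/mpoly_unitP; exists f@_0%MM => //.
by apply: contraNneq nzf => c0; rewrite def_f c0 mpolyC0.
Qed.

Section GenericLine.
Variables (F : fieldType) (n : nat).
Implicit Types f g : {mpoly F[n]}.

Local Notation R := {mpoly F[n + n]}.

Definition gen_pt (j : 'I_n) : R := 'X_(lshift n j).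
Definition gen_dir (j : 'I_n) : R := 'X_(rshift n j).

Definition gen_line : {mpoly F[n]} -> {poly R} := line (@mpolyC (n + n) F) gen_pt gen_dir.

HB.instance Definition _ := GRing.RMorphism.on gen_line.

Definition subst2 (S : comNzRingType) (phi : {rmorphism F -> S})
    (a b : 'I_n -> S) : R -> S :=
  mmap phi (fun i => match split i with inl j => a j | inr j => b j end).

HB.instance Definition _ (S : comNzRingType) (phi : {rmorphism F -> S}) a b :=
  GRing.RMorphism.on (subst2 phi a b).

Lemma subst2x (S : comNzRingType) (phi : {rmorphism F -> S}) (a b : 'I_n -> S) j : subst2 phi a b (gen_pt j) = a j.
Proof.
rewrite /subst2 mmapXU; have /= := unsplitK (inl j : 'I_n + 'I_n).
by move->.
Qed.

Lemma subst2b (S : comNzRingType) (phi : {rmorphism F -> S}) (a b : 'I_n -> S) j : subst2 phi a b (gen_dir j) = b j.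
Proof.
rewrite /subst2 mmapXU; have /= := unsplitK (inr j : 'I_n + 'I_n).
by move->.
Qed.

Lemma subst2C (S : comNzRingType) (phi : {rmorphism F -> S}) (a b : 'I_n -> S) c : subst2 phi a b c%:MP = phi c.
Proof. exact: mmapC. Qed.

Lemma subst2_ext (S : nzRingType) (phi psi : {rmorphism R -> S}) :
  (forall c, phi c%:MP = psi c%:MP) -> (forall j, phi (gen_pt j) = psi (gen_pt j)) ->
  (forall j, phi (gen_dir j) = psi (gen_dir j)) -> phi =1 psi.
Proof.
move=> eqC eqx eqb; apply: mpoly_rmorph_ext => // i.
by rewrite -(splitK i); case: (split i) => j; [apply: eqx | apply: eqb].
Qed.

Lemma map_gen_line (S : comNzRingType) (phi : {rmorphism F -> S}) a b f :
  map_poly (subst2 phi a b) (gen_line f) = line phi a b f.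
Proof.
by apply: map_line => [c|j|j]; [apply: subst2C|apply: subst2x|apply: subst2b].
Qed.

(** Sends the base point [x] to [x + s y b] and fixes the direction [b]. Extended to [R[y]] by
    [shear], the value [s = -1] straightens the generic line: [x + y b] goes back to [x]. *)
Definition shear0 (s : R) : R -> {poly R} :=
  subst2 (polyC \o @mpolyC (n + n) F)
    (fun j => (gen_pt j)%:P + s%:P * ((gen_dir j)%:P * 'X)) (fun j => (gen_dir j)%:P).

HB.instance Definition _ s := GRing.RMorphism.on (shear0 s).

Definition shear (s : R) : {poly R} -> {poly R} := horner_eval 'X \o map_poly (shear0 s).

HB.instance Definition _ s := GRing.RMorphism.on (shear s).

Lemma shearC s c : shear s c%:P = shear0 s c.
Proof. by rewrite /shear /= map_polyC /horner_eval hornerC. Qed.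

Lemma shearX s : shear s 'X = 'X.
Proof. by rewrite /shear /= map_polyX /horner_eval hornerX. Qed.

Lemma shear0x s j : shear0 s (gen_pt j) = (gen_pt j)%:P + s%:P * ((gen_dir j)%:P * 'X).
Proof. exact: subst2x. Qed.

Lemma shear0b s j : shear0 s (gen_dir j) = (gen_dir j)%:P.
Proof. exact: subst2b. Qed.

Lemma shear0C s c : shear0 s c%:MP = c%:MP%:P.
Proof. exact: subst2C. Qed.

Lemma shearK : cancel (shear (-1)) (shear 1).
Proof.
apply: (@poly_rmorph_ext _ _ (shear 1 \o shear (-1)) idfun) => [c|] /=.
  rewrite shearC.
  apply: (@subst2_ext _ (shear 1 \o shear0 (-1)) polyC) => [d|j|j] /=.
  - by rewrite shear0C shearC shear0C.
  - rewrite shear0x rmorphD !rmorphM /= !shearC shearX.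
    rewrite shear0x shear0b.
    have -> : shear0 1 (-1) = -1 by rewrite -mpolyC1 -mpolyCN shear0C mpolyCN polyCN.
    by rewrite polyC1 mul1r mulN1r addrK.
  - by rewrite shear0b shearC shear0b.
by rewrite !shearX.
Qed.

Definition gen_emb : {mpoly F[n]} -> R := mmap (@mpolyC (n + n) F) gen_pt.

Lemma gen_embK f : subst2 (@mpolyC n F) (fun j => 'X_j) (fun=> 0) (gen_emb f) = f.
Proof.
apply: (@mpoly_rmorph_ext _ _ _
  (subst2 (@mpolyC n F) (fun j => 'X_j) (fun=> 0) \o mmap (@mpolyC (n + n) F) gen_pt)
  idfun) => [c|j] /=.
  by rewrite mmapC subst2C.
by rewrite mmapXU subst2x.
Qed.

Lemma shear_gen_line f : shear (-1) (gen_line f) = (gen_emb f)%:P.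
Proof.
apply: (@mpoly_rmorph_ext _ _ _ (shear (-1) \o line (@mpolyC (n + n) F) gen_pt gen_dir)
  (polyC \o mmap (@mpolyC (n + n) F) gen_pt)) => [c|j] /=.
  by rewrite lineC mmapC shearC shear0C.
rewrite lineX mmapXU rmorphD rmorphM /= !shearC shearX.
by rewrite shear0x shear0b polyCN mulN1r addrNK.
Qed.

(** Setting the direction variables to 0 cannot raise a degree. If this makes [a] a constant, then
    [b] already has the whole degree of [f], and [a] is left with degree 0. *)
Lemma unit_gen_factor (a b : R) f :
  f != 0 -> a * b = gen_emb f ->
  subst2 (@mpolyC n F) (fun j => 'X_j) (fun=> 0) a \is a GRing.unit ->
  a \is a GRing.unit.
Proof.
set rho := subst2 _ _ _ => nzf def_ab /mpoly_unitP[c nzc rho_a].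
have nzemb : gen_emb f != 0.
  by apply: contraNneq nzf => e0; rewrite -(gen_embK f) e0 rmorph0.
have [nza nzb] : a != 0 /\ b != 0.
  by apply/andP; rewrite -negb_or -mulf_eq0 def_ab.
have le_b : (msize f <= msize b)%N.
  rewrite -(gen_embK f) -def_ab rmorphM /= -/rho rho_a mul_mpolyC msizeZ //.
  apply: msize_subst_affine => i; case: (split i) => j.
    by rewrite msizeX mdeg1.
  by rewrite msize0.
have le_f : (msize (gen_emb f) <= msize f)%N.
  by apply: msize_subst_affine => i; rewrite msizeX mdeg1.
have : (msize a <= 1)%N.
  have := leq_trans le_f le_b; rewrite -def_ab msizeM //.
  by rewrite (mpolySpred _ nzb) addnS /= -[X in (_ <= X)%N]add1n leq_add2r.
move/msize1_polyC => def_a; apply/mpoly_unitP; exists a@_0%MM => //.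
by apply: contraNneq nza => a0; rewrite def_a a0 mpolyC0.
Qed.

Lemma irreducible_gen_emb (a b : R) f : irreducible_elt f -> a * b = gen_emb f ->
  a \is a GRing.unit \/ b \is a GRing.unit.
Proof.
move=> [nzf _ irrf] def_ab.
pose rho := subst2 (@mpolyC n F) (fun j => 'X_j) (fun=> 0).
have /irrf[u|u] : f = rho a * rho b.
  by rewrite -(gen_embK f) -/rho -def_ab /rho rmorphM.
  by left; apply: unit_gen_factor nzf def_ab u.
by right; apply: unit_gen_factor nzf _ u; rewrite mulrC; exact: def_ab.
Qed.

(** The invertible shear turns the restriction into [f(x)], constant in [y]. Factors of it are
    constant in [y] as well, and adding the direction variables creates no new factorization of
    [f]. *)
Lemma irreducible_gen_line f : irreducible_elt f -> irreducible_elt (gen_line f).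
Proof.
move=> irr_f; have [nzf nuf _] := irr_f; split.
- apply: contraNneq nzf => gen_line0; have := shear_gen_line f.
  rewrite gen_line0 rmorph0 => /esym/eqP.
  by rewrite polyC_eq0 => /eqP e0; rewrite -(gen_embK f) e0 rmorph0.
- apply: contra nuf => /(rmorph_unit (shear (-1))).
  rewrite /= shear_gen_line poly_unitE coefC eqxx => /andP[_ ue].
  by rewrite -(gen_embK f); apply: rmorph_unit.
move=> A B def_AB.
have := congr1 (shear (-1)) def_AB; rewrite shear_gen_line.
rewrite rmorphM /= => def_e.
have : size (shear (-1) A * shear (-1) B) == 1%N.
  rewrite -def_e size_polyC (_ : gen_emb f != 0) //.
  by apply: contraNneq nzf => e0; rewrite -(gen_embK f) e0 rmorph0.
rewrite size_mul_eq1 => /andP[szA szB].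
have unit_of C : size (shear (-1) C) == 1%N -> (shear (-1) C)`_0 \is a GRing.unit ->
    C \is a GRing.unit.
  move=> szC uC; rewrite -(shearK C); apply: (rmorph_unit (shear 1)).
  by rewrite poly_unitE szC.
have def_ab : (shear (-1) A)`_0 * (shear (-1) B)`_0 = gen_emb f.
  by rewrite -coef0M -def_e coefC.
have [u|u] := irreducible_gen_emb irr_f def_ab.
  by left; exact: (unit_of _ szA u).
by right; exact: (unit_of _ szB u).
Qed.

(** With the base point at 0 the generic line becomes [sigma f], whose top coefficient is the
    leading form of [f]. *)
Lemma gen_line_lead f : f != 0 -> (gen_line f)`_(msize f).-1 != 0.
Proof.
move=> nzf; have nzl : (sigma f)`_(msize f).-1 != 0.
  by rewrite -size_sigma -lead_coefE lead_coef_eq0 -size_poly_eq0 size_sigma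
       msize_poly_eq0.
apply: contraNneq nzl => t0.
rewrite /sigma -(map_gen_line (@mpolyC n F)) coef_map t0.
by rewrite raddf0.
Qed.

(** First-order Taylor expansion in the direction of the [j]-th coordinate. The constant coefficient
    is carried along in the induction because the product rule needs it. *)
Lemma coef1_rmorph_deriv j (T : {rmorphism {mpoly F[n]} -> {poly {mpoly F[n]}}}) f :
  (forall c, T c%:MP = c%:MP%:P) ->
  (forall i, T 'X_i = ('X_i)%:P + (i == j)%:R%:P * 'X) ->
  (T f)`_1 = f^`M(j).
Proof.
move=> TC TX; suff [] : (T f)`_0 = f /\ (T f)`_1 = f^`M(j) by [].
elim/mpoly_gen_ind: f => [c|i|f g [f0 f1] [g0 g1]|f g [f0 f1] [g0 g1]].
- by rewrite TC !coefC mderivC.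
- rewrite TX !coefD !coefC !coefMX /= !coefC /= addr0 add0r; split=> //.
  rewrite mderivX mnm1E; case: eqP => [->|_]; last by rewrite scale0r.
  suff -> : (U_(j) - U_(j) = 0)%MM by rewrite mpolyX0 scale1r.
  by apply/mnmP => k; rewrite mnmBE subnn mnm0E.
- by rewrite rmorphD !coefD f0 f1 g0 g1 mderivD.
rewrite rmorphM coef0M coefM !big_ord_recl big_ord0 /= addr0 f0 f1 g0 g1.
by rewrite mderivM addrC.
Qed.

Lemma coef1_line_deriv j f :
  (line (@mpolyC n F) (fun i => 'X_i) (fun i => (i == j)%:R) f)`_1 = f^`M(j).
Proof.
by apply: coef1_rmorph_deriv => [c|i]; [apply: lineC | apply: lineX].
Qed.

Lemma gen_line_deriv_neq0 f j : f^`M(j) != 0 -> (gen_line f)^`() != 0.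
Proof.
apply: contraNneq => t0; rewrite -coef1_line_deriv -(map_gen_line (@mpolyC n F)) coef_map.
have : ((gen_line f)^`())`_0 = 0 by rewrite t0 coef0.
by rewrite coef_deriv mulr1n => ->; rewrite raddf0.
Qed.

Lemma not_divides_gen_line f g : irreducible_elt f -> irreducible_elt g ->
  ~ associated f g -> ~ divides (gen_line f) (gen_line g).
Proof.
move=> irrf irrg nassoc [u def_g]; apply: nassoc.
have [_ nutf _] := irreducible_gen_line irrf.
have [_ _ /(_ _ _ def_g)[uu|]] := irreducible_gen_line irrg; last by rewrite (negPf nutf).
pose rho := map_poly (subst2 (@mpolyC n F) (fun j => 'X_j) (fun=> 0)).
have eval f' : (rho (gen_line f')).[0] = f'.
  rewrite /rho map_gen_line horner_line -[RHS]mmap_idX; apply: mmap_ext => // j.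
  by rewrite mulr0 addr0.
have uw : (rho u).[0] \is a GRing.unit.
  by apply: (rmorph_unit (horner_eval 0 \o rho)).
exists (rho u).[0]^-1; first by rewrite unitrV.
by rewrite -[g]eval def_g /rho rmorphM hornerM -!/(rho _) eval mulKr.
Qed.

Variables (K : closedFieldType) (iota : {rmorphism F -> K}).

(** Each pair [(i, k)] has a Bezout relation with a nonzero constant [c] in [F[x, b]]: against the
    derivative when [i = k], giving simple roots, and against the other factor otherwise, giving
    disjoint roots. The relation survives specialization wherever [c] does not vanish. *)
Lemma generic_line (r : nat) (fs : 'I_r -> {mpoly F[n]}) :
  (forall i, irreducible_elt (fs i)) ->
  (forall i k, associated (fs i) (fs k) -> i = k) ->
  (forall i, exists j, (fs i)^`M(j) != 0) ->
  exists a b : 'I_n -> K, forall i, let U k := line iota a b (fs k) in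
    [/\ size (U i) = msize (fs i), ~~ root (U i) 0,
        forall z, root (U i) z -> ~~ root (U i)^`() z &
        forall k z, k != i -> root (U i) z -> ~~ root (U k) z].
Proof.
move=> irr nassoc sep.
pose h i k := if i == k then (gen_line (fs i))^`() else gen_line (fs k).
have szt i := irreducible_msize (irr i).
have size_gen_line i : size (gen_line (fs i)) = msize (fs i).
  apply/eqP; rewrite eqn_leq size_line /= leqNgt; apply/negP => szlt.
  have [nzf _ _] := irr i; have /negP := gen_line_lead nzf; apply.
  rewrite nth_default // -ltnS prednK //; exact: ltnW.
have /fin_all_exists [c Pc] (ik : 'I_r * 'I_r) : exists c, c != 0 /\
    exists u v, c%:P = u * gen_line (fs ik.1) + v * h ik.1 ik.2.
  case: ik => i k /=.
  have [|||c [u [v [nzc def_c]]]] :=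
    @irreducible_bezout _ (mpoly_ufd F (n + n)) (gen_line (fs i)) (h i k).
  - exact: irreducible_gen_line.
  - by rewrite size_gen_line.
  - rewrite /h; case: eqVneq => [_|neq_ik]; last first.
      apply: not_divides_gen_line => // /nassoc eq_ik; by rewrite eq_ik eqxx in neq_ik.
    (* The derivative is nonzero and of smaller degree, so it is no multiple of
       [gen_line (fs i)]. *)
    case=> u def_d; have [j /gen_line_deriv_neq0 nzd] := sep i.
    have nzu : u != 0 by apply: contraNneq nzd => u0; rewrite def_d u0 mul0r.
    have nzt : gen_line (fs i) != 0 by have [] := irreducible_gen_line (irr i).
    have := lt_size_deriv nzt; rewrite def_d size_mul //.
    rewrite -[size u]prednK ?size_poly_gt0 // addSn /=.
    by rewrite ltnNge leq_addl.
  - by exists c; split=> //; exists u, v.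
(* All that must stay nonzero: the Bezout constants, the top coefficients, which keep the degree
   full, and the constant coefficients, which keep 0 from being a root. *)
pose W := (\prod_i c i) *
  \prod_i ((gen_line (fs i))`_(msize (fs i)).-1 * (gen_line (fs i))`_0).
have nzW : W != 0.
  apply: mulf_neq0; apply/prodf_neq0 => i _; first by have [] := Pc i.
  have [nzf _ _] := irr i; rewrite mulf_neq0 ?gen_line_lead //.
  apply: contraNneq nzf => t0; have := horner_line (@mpolyC (n + n) F) gen_pt gen_dir (fs i) 0.
  rewrite horner_coef0 -/(gen_line _) t0 => /esym e0.
  rewrite -(gen_embK (fs i)); suff -> : gen_emb (fs i) = 0 by rewrite rmorph0.
  by rewrite -e0; apply: mmap_ext => // j; rewrite mulr0 addr0.
have [v nzv] : exists v, (map_mpoly iota W).@[v] != 0.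
  apply: mpoly_nonroot; rewrite -msupp_eq0.
  by rewrite -size_eq0 (perm_size (msupp_map_mpoly _ (fmorph_inj iota))) size_eq0 msupp_eq0.
pose a j := v (lshift n j); pose b j := v (rshift n j).
have {nzv} nzW' : subst2 iota a b W != 0.
  apply: contraNneq nzv => W0; apply/eqP; rewrite -{}W0.
  apply: (@subst2_ext _ (meval v \o map_mpoly iota) (subst2 iota a b)) => [d|j|j] /=.
  - by rewrite map_mpolyC mevalC subst2C.
  - by rewrite map_mpolyX mevalXU subst2x.
  - by rewrite map_mpolyX mevalXU subst2b.
exists a, b => i U; have U_gen_line k : U k = map_poly (subst2 iota a b) (gen_line (fs k)).
  by rewrite map_gen_line.
move: nzW'; rewrite rmorphM mulf_eq0 negb_or !rmorph_prod => /andP[nzc nzt].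
have nzck k l : subst2 iota a b (c (k, l)) != 0.
  by move/prodf_neq0: nzc => /(_ (k, l) isT).
have bez k l z : root (U k) z -> ~~ root (map_poly (subst2 iota a b) (h k l)) z.
  have [_ [u [w /(congr1 (map_poly (subst2 iota a b)))]]] := Pc (k, l).
  rewrite rmorphD !rmorphM /= map_polyC -U_gen_line => def_c /rootP Ukz.
  apply/negP => /rootP hz; have := congr1 (fun P : {poly K} => P.[z]) def_c.
  rewrite hornerC !hornerE Ukz hz !mulr0 addr0 => /eqP.
  by rewrite (negPf (nzck k l)).
move/prodf_neq0: nzt => /(_ i isT); rewrite rmorphM mulf_eq0 negb_or.
rewrite -!coef_map -U_gen_line => /andP[nzl nz0]; split.
- apply/eqP; rewrite eqn_leq size_line /= leqNgt; apply: contraNN nzl => szlt.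
  by rewrite nth_default // -ltnS prednK // ltnW.
- by rewrite rootE horner_coef0.
- by move=> z /(bez i i); rewrite /h eqxx -deriv_map -U_gen_line.
move=> k z neq_ki /(bez i k); rewrite /h eq_sym (negPf neq_ki).
by rewrite -U_gen_line.
Qed.

End GenericLine.

(** * Perfect fields *)

Lemma pchar_expr_inj (F : fieldType) (p k : nat) :
  p \in [pchar F] -> injective (fun x : F => x ^+ (p ^ k)).
Proof.
move=> charF; elim: k => [|k IH] x y //=; rewrite !expnSr !exprM.
by rewrite -!(pFrobenius_autE charF) => /fmorph_inj/IH.
Qed.

(** The powers [x ^+ (p ^ k)] are all roots of one nonzero polynomial over the prime field, whose
    coefficients Frobenius fixes. Hence two of them coincide, and by injectivity of Frobenius [x]
    itself is a power [x ^+ (p ^ k)] with [k] positive. *)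
Lemma algebraic_pth_root (p : nat) (F : fieldType) (K : closedFieldType)
    (phi : {rmorphism 'F_p -> K}) (iota : {rmorphism F -> K}) (x : F) :
  p \in [pchar F] -> prime_field_closure phi -> exists y, x = y ^+ p.
Proof.
move=> charF closureK; have charK := rmorph_pchar iota charF.
have p_pr := pcharf_prime charF.
have [q nzq /rootP qz] := closureK (iota x).
pose fr : {rmorphism K -> K} := pFrobenius_aut charK.
have fr_q : map_poly fr (map_poly phi q) = map_poly phi q.
  apply/polyP => i; rewrite !coef_map /= pFrobenius_autE -rmorphXn.
  by congr (phi _); rewrite -[X in _ ^+ X](card_Fp p_pr) expf_card.
have roots k : root (map_poly phi q) (iota x ^+ (p ^ k)).
  elim: k => [|k /rootP IH]; first by rewrite expn0 expr1; apply/rootP.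
  apply/rootP; rewrite expnSr exprM -[_ ^+ p](pFrobenius_autE charK).
  by rewrite -{1}fr_q (horner_map fr) IH rmorph0.
pose s := mkseq (fun k => iota x ^+ (p ^ k)) (size q).
have /(uniqPn 0) [i [j [lt_ij]]] : ~~ uniq s.
  apply/negP => us; have nzq' : map_poly phi q != 0 by rewrite map_poly_eq0.
  have all_roots : all (root (map_poly phi q)) s.
    by apply/allP => z /mapP[k _ ->].
  have := max_poly_roots nzq' all_roots us.
  by rewrite size_mkseq size_map_poly ltnn.
rewrite size_mkseq => lt_j; rewrite !nth_mkseq ?(ltn_trans lt_ij) //.
rewrite -!rmorphXn => /fmorph_inj.
rewrite -{1}(subnK lt_ij) addnS -addSn expnD exprM => /(pchar_expr_inj charF) ->.
by exists (x ^+ (p ^ (j - i.+1))); rewrite expnSr exprM.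
Qed.

(** If all partial derivatives vanish, every exponent is divisible by [p]; the coefficients being
    [p]-th powers, [f] is then a [p]-th power and not irreducible. *)
Lemma irreducible_mderiv (p n : nat) (F : fieldType) (f : {mpoly F[n]}) :
  p \in [pchar F] -> (forall x : F, exists y, x = y ^+ p) ->
  irreducible_elt f -> exists j, f^`M(j) != 0.
Proof.
move=> charF perfect [nzf nuf irrf]; apply: NNPP => all0.
have charM : p \in [pchar {mpoly F[n]}] by apply: rmorph_pchar (@mpolyC n F) _ charF.
have p_pr := pcharf_prime charF.
have d0 j : f^`M(j) = 0 by apply/eqP/negPn/negP => nz; apply: all0; exists j.
suff [g def_f] : exists g, f = g ^+ p.
  have nug : g \isn't a GRing.unit.
    by apply: contra nuf; rewrite def_f; apply: unitrX.
  have : f = g * g ^+ p.-1 by rewrite -exprS prednK ?prime_gt0.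
  case/irrf; rewrite ?unitrX_pos ?(negPf nug) //.
  by rewrite -ltnS prednK ?prime_gt0 ?prime_gt1.
rewrite (mpolyE f) big_seq; elim/big_ind: _ => [|_ _ [g ->] [h ->]|m suppm].
- by exists 0; rewrite expr0n; case: p p_pr {charF charM perfect}.
- by exists (g + h); rewrite exprDn_pchar // pnatE.
have [c ->] := perfect f@_m; exists (c *: 'X_[[multinom (m j %/ p)%N | j < n]]).
rewrite exprZn mpolyXn; congr (_ *: 'X_[_]); apply/mnmP => j.
rewrite mulmnE mnmE divnK // (dvdn_pcharf charF).
have [->|nzm] := eqVneq (m j) 0%N; first by [].
have def_m : m = (m - U_(j) + U_(j))%MM by rewrite submK // lep1mP.
have := mcoeff_mderiv j f (m - U_(j))%MM; rewrite d0 mcoeff0 -def_m.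
rewrite mnmBE mnm1E eqxx subn1 prednK ?lt0n // -[f@_m *+ _]mulr_natr => /esym/eqP.
by rewrite mulf_eq0 mcoeff_eq0 suppm.
Qed.

(** * Power series approximation *)

Section Adic.
Variables (K : fieldType) (n : nat).
Implicit Types f g u w : {mpoly K[n]}.

(** Order at least [N] at the origin. Congruence of polynomials to this order stands for equality of
    truncated power series. *)
Definition vanishes N f := exists g : {poly {mpoly K[n]}}, sigma f = g * 'X^N.

Lemma vanishes_le N M f : (N <= M)%N -> vanishes M f -> vanishes N f.
Proof.
move=> leNM [g def_f]; exists (g * 'X^(M - N)).
by rewrite -mulrA -exprD subnK.
Qed.

Lemma vanishes0 N : vanishes N 0.
Proof. by exists 0; rewrite rmorph0 mul0r. Qed.

Lemma vanishesD N f g : vanishes N f -> vanishes N g -> vanishes N (f + g).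
Proof. by move=> [a fa] [b gb]; exists (a + b); rewrite rmorphD /= mulrDl fa gb. Qed.

Lemma vanishesM N M f g : vanishes N f -> vanishes M g -> vanishes (N + M) (f * g).
Proof.
by move=> [a fa] [b gb]; exists (a * b); rewrite rmorphM /= fa gb exprD mulrACA.
Qed.

Lemma vanishesMl N f g : vanishes N g -> vanishes N (f * g).
Proof. by rewrite -{2}(add0n N); apply: vanishesM; exists (sigma f); rewrite mulr1. Qed.

Lemma vanishesMr N f g : vanishes N f -> vanishes N (f * g).
Proof. by rewrite mulrC; apply: vanishesMl. Qed.

Lemma vanishesN N f : vanishes N f -> vanishes N (- f).
Proof. by rewrite -mulN1r; apply: vanishesMl. Qed.

Lemma vanishesB N f g : vanishes N f -> vanishes N g -> vanishes N (f - g).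
Proof. by move=> vf vg; apply/vanishesD/vanishesN. Qed.

Lemma vanishesX k f : vanishes 1 f -> vanishes k (f ^+ k).
Proof.
move=> vf; elim: k => [|k IH]; first by exists (sigma (f ^+ 0)); rewrite mulr1.
by rewrite exprS -add1n; apply: vanishesM.
Qed.

Lemma coef0_sigma f : (sigma f)`_0 = (f@_0%MM)%:MP.
Proof.
apply/mpolyP => m; rewrite coef_sigma mcoeffC mdeg_eq0.
by case: eqVneq => [->|_]; rewrite ?mulr1 ?mulr0.
Qed.

Lemma poly_coef0 (S : nzRingType) (P : {poly S}) :
  P`_0 = 0 -> exists Q, P = Q * 'X.
Proof.
elim/poly_ind: P => [|Q c _]; first by exists 0; rewrite mul0r.
rewrite coefD coefMX coefC /= add0r => ->.
by exists Q; rewrite addr0.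
Qed.

Lemma vanishes1P f : vanishes 1 f <-> f@_0%MM = 0.
Proof.
split=> [[g def_f]|f0].
  have := coef0_sigma f; rewrite def_f expr1 coefMX eqxx => /esym/eqP.
  by rewrite mpolyC_eq0 => /eqP.
by have [|Q def_f] := @poly_coef0 _ (sigma f);
  [rewrite coef0_sigma f0 mpolyC0 | exists Q].
Qed.

(** [u] is invertible as a power series. The proof cancels one factor of [T] at a time, by looking
    at constant coefficients. *)
Lemma vanishes_unit N u w : u@_0%MM != 0 -> vanishes N (u * w) -> vanishes N w.
Proof.
move=> nzu; elim: N => [|N IH] vuw; first by exists (sigma w); rewrite mulr1.
have [g def_w] := IH (vanishes_le (leqnSn N) vuw).
have [h] := vuw; rewrite rmorphM /= def_w exprS !mulrA.
move/(mulIf (monic_neq0 (monicXn _ N))).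
move/(congr1 (fun P : {poly {mpoly K[n]}} => P`_0)).
rewrite [LHS]coef0M [RHS]coefMX eqxx coef0_sigma => /eqP.
rewrite mulf_eq0 mpolyC_eq0 (negPf nzu) => /eqP/poly_coef0[Q def_g].
by exists Q; rewrite def_w def_g exprS mulrA.
Qed.

Lemma coef_sigma_vanishes N f k : vanishes N f -> (k < N)%N -> (sigma f)`_k = 0.
Proof. by move=> [g ->] lt_kN; rewrite coefMXn lt_kN. Qed.

Lemma homogeneous_trunc N f g : (msize g <= N)%N -> vanishes N (g - f) ->
  g = \sum_(k < N) (sigma f)`_k.
Proof.
move=> szg vgf; rewrite -[LHS]sigma_horner1 (@horner_coef_wide _ N) ?size_sigma //.
apply: eq_bigr => k _; rewrite expr1n mulr1; apply/eqP.
by rewrite -subr_eq0 -coefB -rmorphB (coef_sigma_vanishes vgf).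
Qed.

End Adic.

(** * Taylor expansion and Hasse derivatives *)

Section Taylor.
Variable S : comNzRingType.
Implicit Types (P Q : {poly S}) (x y h : S).

Lemma taylor1 P y h : exists c, P.[y + h] = P.[y] + c * h.
Proof.
elim/poly_ind: P => [|P c [d IH]]; first by exists 0; rewrite !horner0 mul0r addr0.
by exists (P.[y] + d * (y + h)); rewrite !hornerE IH; ring.
Qed.

Lemma taylor2 P y h : exists c, P.[y + h] = P.[y] + P^`().[y] * h + c * h ^+ 2.
Proof.
elim/poly_ind: P => [|P c [d IH]].
  by exists 0; rewrite deriv0 !horner0 !mul0r !addr0.
exists (P^`().[y] + d * (y + h)).
by rewrite derivD derivM derivX derivC !hornerE /= IH; ring.
Qed.

(** Hasse derivatives are Taylor coefficients in every characteristic, so multiplicities can be read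
    off from them even when they exceed [p]. *)
Lemma nderivn_horner P k x : P^`N(k).[x] = (P \Po ('X + x%:P))`_k.
Proof.
elim/poly_ind: P k => [|P c IH] k.
  by rewrite comp_poly0 coef0 nderivn_poly0 ?size_poly0 // horner0.
rewrite comp_polyD comp_polyM comp_polyX comp_polyC coefD coefC mulrDr coefD.
rewrite coefMX coefMC; case: k => [|k] /=.
  by rewrite nderivn0 hornerMXaddC add0r -IH nderivn0.
by rewrite nderivnMXaddC hornerD hornerMX !IH addr0.
Qed.

Lemma nderivn_deriv P k : P^`N(k)^`() = P^`N(k.+1) *+ k.+1.
Proof.
apply/polyP => i; rewrite coef_deriv coefMn !coef_nderivn addSn addnS -!mulrnA.
congr (_ *+ _); rewrite mulnC [RHS]mulnC mul_bin_left; congr (_ * _)%N.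
by rewrite subSn ?leq_addr // addKn.
Qed.

Lemma nderivn_mul_XsubC P Q x m k : P = ('X - x%:P) ^+ m * Q -> (k <= m)%N ->
  P^`N(k).[x] = if k == m then Q.[x] else 0.
Proof.
move=> -> lekm; rewrite nderivn_horner rmorphM rmorphXn /= comp_polyB comp_polyX.
rewrite comp_polyC addrK coefXnM ltn_neqAle lekm andbT.
case: eqVneq => //= ->; rewrite subnn -horner_coef0 horner_comp.
by rewrite !hornerE.
Qed.

(** Modulo [P.[x]] the point [x] is a root of [P], hence a root of multiplicity at least [m] of
    [P ^+ m * Q], and the Taylor coefficient of order [k < m] vanishes there. *)
Lemma nderivn_approx_root P Q x m k : (k < m)%N ->
  exists c, (P ^+ m * Q)^`N(k).[x] = P.[x] * c.
Proof.
move=> ltkm; rewrite nderivn_horner rmorphM rmorphXn /=.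
set P' := P \Po _; have [q def_P] : exists q, P' - (P.[x])%:P = q * 'X.
  apply: poly_coef0; rewrite coefB coefC /= -horner_coef0 horner_comp !hornerE.
  by rewrite subrr.
have [u def_Pm] : exists u, P' ^+ m = q ^+ m * 'X^m + (P.[x])%:P * u.
  move/(canRL (subrK _)): def_P => ->; elim: {ltkm} m => [|m [u IH]].
    by exists 0; rewrite !expr0 !mulr0 addr0 mulr1.
  exists (q * 'X * u + q ^+ m * 'X^m + (P.[x])%:P * u).
  by rewrite exprS IH !exprS; ring.
exists (u * (Q \Po ('X + x%:P)))`_k.
by rewrite def_Pm mulrDl coefD mulrAC coefMXn ltkm add0r -mulrA coefCM.
Qed.

End Taylor.

(** * Cost measures and Newton iteration *)

Record cost_measure (K : closedFieldType) (n kap : nat)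
    (L : {mpoly K[n]} -> nat -> Prop) : Prop := CostMeasure {
  cost_mono : forall f s t, (s <= t)%N -> L f s -> L f t;
  cost_const : forall c, L c%:MP 1%N;
  cost_sum : forall N (f : 'I_N -> {mpoly K[n]}) s, (0 < s)%N ->
    (forall i, L (f i) s) -> L (\sum_i f i) (kap * N.+1 * s)%N;
  cost_prod : forall N (f : 'I_N -> {mpoly K[n]}) s, (0 < s)%N ->
    (forall i, L (f i) s) -> L (\prod_i f i) (kap * N.+1 * s)%N;
  cost_affine : forall (v w : 'I_n -> K) f s, (0 < s)%N -> L f s ->
    L (mmap (@mpolyC n K) (fun j => (v j)%:MP + (w j)%:MP * 'X_j) f) (kap * s)%N
}.

(** The weights are the entries of the inverse of a Vandermonde matrix on [N] distinct constants,
    available because [K] is infinite. *)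
Lemma interpolation (K : closedFieldType) (n N : nat) :
  exists (t : 'I_N -> K) (w : 'I_N -> 'I_N -> K),
    forall P : {poly {mpoly K[n]}}, (size P <= N)%N -> forall k : 'I_N,
      P`_k = \sum_l w k l *: P.[(t l)%:MP].
Proof.
have [s szs us] := closed_field_points K N.
pose a : 'rV[K]_N := \row_l s`_l; pose V := Vandermonde N a.
have uV : V \in unitmx.
  rewrite unitmxE det_Vandermonde unitfE; apply/prodf_neq0 => i _.
  apply/prodf_neq0 => j lt_ij; rewrite !mxE subr_eq0 nth_uniq ?szs //.
  by rewrite eq_sym ltn_eqF.
exists (fun l => s`_l), (fun k l => invmx V l k) => P szP k.
under eq_bigr => l _ do rewrite (horner_coef_wide _ szP) scaler_sumr.
rewrite exchange_big /=.
have inner (i : 'I_N) : \sum_l invmx V l k *: (P`_i * (s`_l)%:MP ^+ i) =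
    (i == k)%:R *: P`_i.
  transitivity ((V *m invmx V) i k *: P`_i); last by rewrite mulmxV // mxE.
  rewrite mxE scaler_suml; apply: eq_bigr => l _.
  by rewrite [V i l]mxE mxE -!mul_mpolyC -rmorphXn /= mpolyCM; ring.
rewrite (eq_bigr _ (fun i _ => inner i)) (bigD1 k) //= eqxx scale1r big1 ?addr0 //.
by move=> i /negPf->; rewrite scale0r.
Qed.

(** * Cost and degree counted in powers of a linear function of [D] *)

Section Levels.
Variables (K : closedFieldType) (n kap : nat) (L : {mpoly K[n]} -> nat -> Prop).
Hypotheses (L_cost : cost_measure kap L) (kap_gt0 : (0 < kap)%N).
Variables (D s : nat).
Hypothesis s_gt0 : (0 < s)%N.
Implicit Types f g y z : {mpoly K[n]}.

Local Notation X := (kap * D.+3)%N.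

(* Bounding the degree along with the cost lets the level also control the number
   of interpolation nodes needed to extract homogeneous components. *)
Definition lev k f := L f (X ^ k * s) /\ (msize f <= D.+2 ^ k.+1)%N.

Let X_gt0 : (0 < X)%N. Proof. by rewrite muln_gt0 kap_gt0. Qed.
Let Xk_gt0 k : (0 < X ^ k * s)%N. Proof. by rewrite muln_gt0 expn_gt0 X_gt0. Qed.

Lemma lev_mono k l f : (k <= l)%N -> lev k f -> lev l f.
Proof.
move=> le_kl [Lf szf]; split.
  by apply: (cost_mono L_cost _ Lf); rewrite leq_mul // leq_pexp2l.
by apply: leq_trans szf _; rewrite leq_pexp2l.
Qed.

Lemma lev_const k c : lev k c%:MP.
Proof.
apply: (@lev_mono 0) => //; split; last by rewrite msizeC; case: eqP.
by apply: (cost_mono L_cost _ (cost_const L_cost c)); rewrite mul1n.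
Qed.

Lemma lev_sum k m N (f : 'I_N -> {mpoly K[n]}) : (N <= D.+2 ^ m)%N ->
  (forall i, lev k (f i)) -> lev (k + m.+1) (\sum_i f i).
Proof.
move=> leN lf; split.
  apply: (cost_mono L_cost _ (cost_sum L_cost (Xk_gt0 k) (fun i => proj1 (lf i)))).
  rewrite [(k + _)%N]addnC expnD -[leqRHS]mulnA leq_mul2r; apply/orP; right.
  apply: (@leq_trans (kap * D.+3 ^ m.+1)%N).
    rewrite leq_mul2l; apply/orP; right.
    apply: (@leq_trans (D.+3 ^ m).+1).
      by rewrite ltnS; apply: leq_trans leN _; case: (m) => // l; rewrite leq_exp2r.
    rewrite expnS; apply: (@leq_trans (2 * D.+3 ^ m)).
      by rewrite mul2n -addnn -addn1 leq_add2l expn_gt0.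
    by rewrite leq_mul2r orbT.
  by rewrite expnMn leq_mul2r [(kap ^ _)%N]expnS leq_pmulr ?orbT // expn_gt0 kap_gt0.
apply: msize_sum_leq => i _; apply: leq_trans (proj2 (lf i)) _.
by rewrite leq_pexp2l // ltnS leq_addr.
Qed.

Lemma lev_prod k N (f : 'I_N -> {mpoly K[n]}) : (N <= D.+2)%N ->
  (forall i, lev k (f i)) -> lev k.+1 (\prod_i f i).
Proof.
move=> leN lf; split.
  apply: (cost_mono L_cost _ (cost_prod L_cost (Xk_gt0 k) (fun i => proj1 (lf i)))).
  by rewrite expnS -[leqRHS]mulnA leq_mul2r leq_mul2l ltnS leN !orbT.
have E_gt0 : (0 < D.+2 ^ k.+1)%N by rewrite expn_gt0.
apply: leq_trans (@msize_prod_leq _ _ _ _ _ _ (fun=> (D.+2 ^ k.+1).-1) _) _.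
  by move=> i _; rewrite prednK //; case: (lf i).
rewrite sum_nat_const card_ord [in leqRHS]expnS.
apply: (@leq_trans (D.+2 * (D.+2 ^ k.+1).-1).+1).
  by rewrite ltnS leq_mul2r leN orbT.
rewrite -[in leqRHS](prednK E_gt0) [in leqRHS]mulnS.
by rewrite -[leqLHS]add1n leq_add2r.
Qed.

Lemma lev_add k f g : lev k f -> lev k g -> lev (k + 2) (f + g).
Proof.
move=> lf lg; have := @lev_sum k 1 2 (fun i => if i == ord0 then f else g).
rewrite big_ord_recl big_ord1 /=; apply=> // i; by case: ifP.
Qed.

Lemma lev_mul k f g : lev k f -> lev k g -> lev k.+1 (f * g).
Proof.
move=> lf lg; have := @lev_prod k 2 (fun i => if i == ord0 then f else g).
rewrite big_ord_recl big_ord1 /=; apply=> // i; by case: ifP.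
Qed.

Lemma lev_exp k f i : (i <= D.+2)%N -> lev k f -> lev k.+1 (f ^+ i).
Proof.
by move=> lei lf; rewrite -[i]card_ord -prodr_const; apply: lev_prod.
Qed.

Lemma lev_scale k c f : lev k f -> lev k.+1 (c *: f).
Proof. by move=> lf; rewrite -mul_mpolyC; apply: lev_mul => //; apply: lev_const. Qed.

Lemma lev_opp k f : lev k f -> lev k.+1 (- f).
Proof. by rewrite -scaleN1r; apply: lev_scale. Qed.

Lemma lev_sub k f g : lev k f -> lev k g -> lev (k + 3) (f - g).
Proof.
move=> lf lg; rewrite addnS -addSn; apply: lev_add; last exact: lev_opp.
exact: lev_mono lf.
Qed.

Lemma lev_affine k (v w : 'I_n -> K) h f :
  (forall j, h j = (v j)%:MP + (w j)%:MP * 'X_j) -> lev k f ->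
  lev k.+1 (mmap (@mpolyC n K) h f).
Proof.
move=> def_h [Lf szf].
have -> : mmap (@mpolyC n K) h f =
    mmap (@mpolyC n K) (fun j => (v j)%:MP + (w j)%:MP * 'X_j) f.
  exact: mmap_ext.
split.
  apply: (cost_mono L_cost _ (cost_affine L_cost v w (Xk_gt0 k) Lf)).
  by rewrite expnS -[leqRHS]mulnA leq_mul2r leq_pmulr ?orbT.
apply: leq_trans (msize_subst_affine _ _) _ => [j|].
  apply: leq_trans (msizeD_le _ _) _; rewrite geq_max msizeC mul_mpolyC.
  rewrite (leq_trans (leq_b1 _)) // (leq_trans (msizeZ_le _ _)) //.
  by rewrite msizeX mdeg1.
by apply: leq_trans szf _; rewrite leq_pexp2l.
Qed.

Lemma lev_coef k m (P : {poly {mpoly K[n]}}) : (size P <= D.+2 ^ m)%N ->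
  (forall t, lev k P.[t%:MP]) -> forall i, lev (k + m.+2) P`_i.
Proof.
move=> szP lP i; have [ltiN|leNi] := ltnP i (D.+2 ^ m); last first.
  by rewrite nth_default ?(leq_trans szP) // -mpolyC0; apply: lev_const.
have [t [w def_P]] := interpolation K n (D.+2 ^ m).
rewrite (def_P P szP (Ordinal ltiN)) addnS -addSn; apply: lev_sum => // l.
exact: lev_scale.
Qed.

Lemma lev_horner k (E : {poly {mpoly K[n]}}) y : (size E <= D.+2)%N ->
  (forall i, lev k E`_i) -> lev k y -> lev (k + 4) E.[y].
Proof.
move=> szE lE ly; rewrite horner_coef (_ : (k + 4 = k.+2 + 2)%N); last by lia.
apply: lev_sum => [|i]; first by rewrite expn1.
apply: lev_mul; first exact: lev_mono (lE i).
by apply: lev_exp => //; apply: leq_trans szE; apply: ltnW.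
Qed.

(** At level [k] the degree may be of order [D.+2 ^ k.+1], and isolating a homogeneous component
    takes that many interpolation nodes. This is why the level doubles. *)
Lemma lev_trunc k f : lev k f -> lev (2 * k + 6) (\sum_(i < D.+1) (sigma f)`_i).
Proof.
move=> lf; rewrite (_ : (2 * k + 6 = (k.+1 + k.+3) + 2)%N); last by lia.
apply: lev_sum => [|i]; first by rewrite expn1.
apply: lev_coef => [|t]; first by rewrite size_sigma; case: lf.
rewrite horner_line; apply: (@lev_affine _ (fun=> 0) (fun=> t)) => // j.
by rewrite mpolyC0 !add0r mulrC.
Qed.

Lemma lev_division f g h : f = g * h -> f != 0 -> (msize f <= D.+1)%N ->
  g@_0%MM != 0 -> lev 0 f -> lev 0 g -> lev 24 h.
Proof.
move=> def_f nzf szf nzg lf lg.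
have [nzg' nzh] : g != 0 /\ h != 0.
  by apply/andP; rewrite -negb_or -mulf_eq0 -def_f.
have szh : (msize h <= D.+1)%N.
  apply: leq_trans szf; rewrite def_f msizeM // (mpolySpred _ nzg') addSn.
  exact: leq_addl.
pose c := (g@_0%MM)^-1; pose w := 1 - c *: g.
pose S := \sum_(i < D.+1) w ^+ i.
have -> : h = \sum_(i < D.+1) (sigma (f * (c *: S)))`_i.
  apply: homogeneous_trunc => //.
  (* The error of the truncated geometric series is exactly [h * w ^+ D.+1], and [w] has no constant
     term. *)
  have -> : h - f * (c *: S) = h * w ^+ D.+1.
    have : (1 - w) * S = 1 - w ^+ D.+1.
      by rewrite -{1}[w]expr1 -[1 in RHS](expr1n _ D.+1) subrXX expr1;
         congr (_ * _); apply: eq_bigr => i _; rewrite expr1n mul1r.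
    rewrite /w opprB addrCA subrr addr0 -/w => eq_S.
    rewrite def_f -!mul_mpolyC; move: eq_S; rewrite -mul_mpolyC => eq_S.
    have -> : w ^+ D.+1 = 1 - c%:MP * g * S by rewrite eq_S; ring.
    by ring.
  apply/vanishesMl/vanishesX/vanishes1P; rewrite /w mcoeffB mcoeff1 eqxx mcoeffZ.
  by rewrite mulVf ?subrr.
apply: (@lev_trunc 9); apply: lev_mul; first exact: lev_mono lf.
apply: lev_scale; apply: (@lev_sum 5 1) => [|i]; first by rewrite expn1.
apply: lev_exp; first by apply: leq_trans (ltnW (ltn_ord i)) _.
rewrite -[4%N]/(1 + 3)%N; apply: lev_sub; last exact: lev_scale.
by rewrite -mpolyC1; apply: lev_const.
Qed.

(** An approximate inverse [z] of the derivative is refined along with [y], so no division occurs.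
    Both updates square the error: Taylor's formula for [y], and [e x (2 - x e) - 1 = -(e x - 1)^2]
    for [z]. *)
Lemma newton_step (E : {poly {mpoly K[n]}}) N y z
    (y' := y - E.[y] * z) (z' := z * (2%:R - z * E^`().[y'])) :
  (0 < N)%N -> vanishes N E.[y] -> vanishes N (E^`().[y] * z - 1) ->
  [/\ vanishes (N + N) E.[y'], vanishes (N + N) (E^`().[y'] * z' - 1) &
      y'@_0%MM = y@_0%MM].
Proof.
move=> N_gt0 vE vE'; split.
- have [c def_c] := taylor2 E y (- (E.[y] * z)).
  rewrite /y' def_c.
  have -> : E.[y] + E^`().[y] * - (E.[y] * z) + c * (- (E.[y] * z)) ^+ 2 =
    (c * z ^+ 2) * (E.[y] * E.[y]) - E.[y] * (E^`().[y] * z - 1) by ring.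
  exact: (vanishesB (vanishesMl _ (vanishesM vE vE)) (vanishesM vE vE')).
- have [c def_c] := taylor1 E^`() y (- (E.[y] * z)).
  have ve : vanishes N (E^`().[y'] * z - 1).
    rewrite /y' def_c.
    have -> : (E^`().[y] + c * - (E.[y] * z)) * z - 1 =
      (E^`().[y] * z - 1) - (c * z ^+ 2) * E.[y] by ring.
    exact: (vanishesB vE' (vanishesMl _ vE)).
  have sq (e x : {mpoly K[n]}) :
      e * (x * (2%:R - x * e)) - 1 = - ((e * x - 1) * (e * x - 1)) by ring.
  by rewrite /z' sq; exact: (vanishesN (vanishesM ve ve)).
rewrite /y' mcoeffB; have /vanishes1P -> : vanishes 1 (E.[y] * z).
  by apply: vanishesMr; apply: vanishes_le vE.
by rewrite subr0.
Qed.

(* A is the level predicate when the iterates are computed, and True when a root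
   is only shown to exist. *)
Lemma newton (A : nat -> {mpoly K[n]} -> Prop) (d k : nat)
    (E : {poly {mpoly K[n]}}) (a : K) :
  (forall c, A k c%:MP) ->
  (forall l y z (y' := y - E.[y] * z), (k <= l)%N -> A l y -> A l z ->
     A (l + d)%N y' /\ A (l + d)%N (z * (2%:R - z * E^`().[y']))) ->
  root (map_poly (mcoeff 0%MM) E) a ->
  ~~ root (map_poly (mcoeff 0%MM) E)^`() a ->
  forall t, exists y, [/\ A (k + d * t)%N y, vanishes (2 ^ t) E.[y] & y@_0%MM = a].
Proof.
move=> AC Astep Ea E'a t.
suff [y [z [Ay _ vy _ ya]]] : exists y z, [/\ A (k + d * t)%N y, A (k + d * t)%N z,
    vanishes (2 ^ t) E.[y], vanishes (2 ^ t) (E^`().[y] * z - 1) & y@_0%MM = a].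
  by exists y.
elim: t => [|t [y [z [Ay Az vy vz ya]]]].
  have ev (P : {poly {mpoly K[n]}}) :
      P.[a%:MP]@_0%MM = (map_poly (mcoeff 0%MM) P).[a].
    by rewrite -{2}[a]mulr1 -[1 in RHS]/(true%:R) -(eqxx (0%MM : 'X_{1..n})) -mcoeffC horner_map.
  (* The iteration starts from the constants [a] and the inverse of the derivative at [a], correct
     to order 1. *)
  exists a%:MP, ((map_poly (mcoeff 0%MM) E)^`().[a])^-1%:MP; rewrite muln0 addn0.
  split=> //; last by rewrite mcoeffC eqxx mulr1.
    by apply/vanishes1P; rewrite ev; apply/eqP.
  apply/vanishes1P; rewrite mcoeffB mulrC mcoeffCM ev mcoeff1 eqxx deriv_map.
  by rewrite mulVf ?subrr // -deriv_map.
have [v1 v2 ya'] := newton_step (expn_gt0 2 t) vy vz.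
have [Ay' Az'] := Astep _ _ _ (leq_addr _ _) Ay Az.
rewrite mulnS addnCA addnC expnS mul2n -addnn.
by eexists; eexists; split; [exact: Ay'|exact: Az'|exact: v1|exact: v2|rewrite ya'].
Qed.

End Levels.

(** * Extraction of a factor *)

(** A factor [y] can only come from an [x_j] that it replaces, so [x] and [y] share the total
    degree. In particular a coefficient of [y] to the full degree of [f] is constant. *)
Lemma msize_coef_line (K : fieldType) n (b : 'I_n -> K) (f : {mpoly K[n]}) k :
  (msize (line (@mpolyC n K) (fun j => 'X_j) (fun j => (b j)%:MP) f)`_k
     <= msize f - k)%N.
Proof.
pose H d (P : {poly {mpoly K[n]}}) := forall k, (msize P`_k <= d.+1 - k)%N.
have HM d e P Q : H d P -> H e Q -> H (d + e)%N (P * Q).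
  move=> HP HQ l; rewrite coefM; apply: msize_sum_leq => i _.
  have [->|nzP] := eqVneq P`_i 0; first by rewrite mul0r msize0.
  have [->|nzQ] := eqVneq Q`_(l - i) 0; first by rewrite mulr0 msize0.
  have := HP i; have := HQ (l - i)%N; rewrite msizeM //.
  rewrite (mpolySpred _ nzP) (mpolySpred _ nzQ); have := ltn_ord i.
  move: (msize P`_i).-1 (msize Q`_(l - i)).-1 (nat_of_ord i) => x y i'.
  by lia.
have H1 : H 0%N 1.
  by case=> [|l]; rewrite coef1 ?msize1 ?msize0.
have Hlin j : H 1%N (('X_j)%:P + (b j)%:MP%:P * 'X).
  move=> l; rewrite coefD coefC coefCM coefX; case: l => [|[|l]] /=.
  - by rewrite mulr0 addr0 msizeX mdeg1.
  - by rewrite add0r mulr1 msizeC leq_b1.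
  - by rewrite mulr0 addr0 msize0.
rewrite /line /mmap coef_sum big_seq; apply: msize_sum_leq => m suppm.
rewrite /= coefCM mul_mpolyC; apply: leq_trans (msizeZ_le _ _) _.
apply: (@leq_trans ((mdeg m).+1 - k)); last by rewrite leq_sub2r // msize_mdeg_lt.
move: k; rewrite -/(H _ _) /mmap1 mdegE; elim/big_rec2: _ => // j d P _ HP.
apply: (HM) => //; elim: (m j) => // l IH; rewrite exprS -add1n.
exact: HM.
Qed.

(** [P - P.[y]] is exactly divisible by ['X - y], at the price of an error [P.[y]] of order [N]. The
    other points remain approximate roots of the quotient because their differences with [y] are
    nonzero at the origin. *)
Lemma approx_factorization (K : fieldType) n N (ys : seq {mpoly K[n]})
    (P : {poly {mpoly K[n]}}) x :
  size P = (size ys).+1 -> uniq [seq y@_0%MM | y <- ys] ->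
  (forall y, y \in ys -> vanishes N P.[y]) ->
  vanishes N (P.[x] - lead_coef P * \prod_(y <- ys) (x - y)).
Proof.
elim: ys P => [|y ys IH] P szP /=.
  move=> _ _; rewrite big_nil mulr1 (size1_polyC (eq_leq szP)) hornerC lead_coefC.
  by rewrite subrr; apply: vanishes0.
case/andP=> y_ys uys vP.
have /factor_theorem [q def_q] : root (P - (P.[y])%:P) y.
  by rewrite rootE !hornerE subrr.
have szP' : size (P - (P.[y])%:P) = size P.
  by rewrite size_addl // size_opp size_polyC szP; case: eqP.
have lcP' : lead_coef (P - (P.[y])%:P) = lead_coef P.
  by rewrite lead_coefDl // size_opp size_polyC szP; case: eqP.
have Pz z : P.[z] = q.[z] * (z - y) + P.[y].
  have := congr1 (fun Q : {poly {mpoly K[n]}} => Q.[z]) def_q.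
  by rewrite !hornerE => /(canRL (subrK _)).
have nzq : q != 0.
  by apply/eqP => q0; move: szP'; rewrite def_q q0 mul0r size_poly0 szP.
have szq : size q = (size ys).+1.
  move: szP'; rewrite def_q size_Mmonic ?monicXsubC // size_XsubC addn2 szP /=.
  by case.
rewrite big_cons Pz -lcP' def_q lead_coef_Mmonic ?monicXsubC //.
have -> : forall (A B C E F : {mpoly K[n]}),
    A * B + C - E * (B * F) = (A - E * F) * B + C by move=> *; ring.
apply: vanishesD; last by apply: vP; rewrite mem_head.
apply: vanishesMr; apply: IH => // y' ys_y'.
apply: (@vanishes_unit _ _ _ (y' - y)).
  rewrite mcoeffB subr_eq0; apply: contraNneq y_ys => <-.
  by apply/mapP; exists y'.
rewrite mulrC -[_ * _](addrK P.[y]) -Pz; apply: vanishesB; apply: vP.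
  by rewrite in_cons ys_y' orbT.
by rewrite mem_head.
Qed.

Lemma lift_seq (A B : eqType) (h : A -> B) (Q : A -> Prop) (s : seq B) :
  (forall b, b \in s -> exists a, Q a /\ h a = b) ->
  exists t, [seq h a | a <- t] = s /\ (forall a, a \in t -> Q a).
Proof.
elim: s => [|b s IH] lift; first by exists [::].
have [|t [def_s Qt]] := IH.
  by move=> c sc; apply: lift; rewrite in_cons sc orbT.
have [a [Qa <-]] := lift b (mem_head _ _).
exists (a :: t); rewrite /= def_s; split=> // c.
by rewrite in_cons => /orP[/eqP->|/Qt].
Qed.

Section Stage.
Variables (K : closedFieldType) (n kap : nat) (L : {mpoly K[n]} -> nat -> Prop).
Hypotheses (L_cost : cost_measure kap L) (kap_gt0 : (0 < kap)%N).
Variables (D s : nat).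
Hypothesis s_gt0 : (0 < s)%N.

Local Notation lev := (lev kap L D s).

Variables (beta : 'I_n -> K) (C g R : {mpoly K[n]}) (m t : nat).

Local Notation U := (line (idfun : {rmorphism K -> K}) (fun=> 0) beta).
Local Notation T :=
  (line (@mpolyC n K) (fun j => 'X_j) (fun j => (beta j)%:MP)).

Hypotheses (def_C : C = g ^+ m * R) (nzm : m%:R != 0 :> K) (nzg : g != 0).
Hypothesis sizeU : size (U g) = msize g.
Hypothesis simple : forall a, root (U g) a -> ~~ root (U g)^`() a.
Hypothesis others : forall a, root (U g) a -> ~~ root (U R) a.
Hypotheses (szC : (msize C <= D.+1)%N) (szg : (msize g <= D.+1)%N).
Hypothesis lt_D : (D < 2 ^ t)%N.
Hypothesis lev_C : lev 0 C.

Let m_gt0 : (0 < m)%N.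
Proof. by case: m nzm => //; rewrite eqxx. Qed.

Let map_T f : map_poly (mcoeff 0%MM) (T f) = U f.
Proof.
apply: map_line => [c|j|j] /=; rewrite ?mcoeffC ?eqxx ?mulr1 //.
by rewrite mcoeffX mnm1_eq0.
Qed.

(** The polynomial Newton's iteration works on: a root of multiplicity [m] of [U C] is a simple root
    of its reduction at [x = 0]. *)
Let E := (T C)^`N(m.-1).

Let map_E : map_poly (mcoeff 0%MM) E = (U C)^`N(m.-1).
Proof. by rewrite /E -nderivn_map map_T. Qed.

Let factor_U a : root (U g) a ->
  exists2 w, U C = ('X - a%:P) ^+ m * w & w.[a] != 0.
Proof.
move=> ra; have /factor_theorem [q def_q] := ra.
exists (q ^+ m * U R).
  by rewrite def_C rmorphM rmorphXn /= def_q exprMn mulrAC mulrC mulrA.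
rewrite hornerM mulf_neq0 //; last by have := others ra.
rewrite horner_exp expf_neq0 //; have := simple ra.
by rewrite def_q derivM derivXsubC rootE !hornerE subrr mulr0 add0r.
Qed.

Let root_E a : root (U g) a -> root (map_poly (mcoeff 0%MM) E) a.
Proof.
case/factor_U => w def_w _; rewrite map_E rootE.
rewrite (nderivn_mul_XsubC def_w) ?leq_pred //.
by have /negPf -> : m.-1 != m by have := m_gt0; lia.
Qed.

Let root_E' a : root (U g) a -> ~~ root (map_poly (mcoeff 0%MM) E)^`() a.
Proof.
case/factor_U => w def_w nzw; rewrite map_E nderivn_deriv prednK // rootE.
rewrite hornerMn (nderivn_mul_XsubC def_w) // eqxx.
by rewrite -mulr_natr mulf_neq0.
Qed.

Let size_E : (size E <= D.+1)%N.
Proof.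
apply: leq_trans (size_poly _ _) _; apply: leq_trans (leq_subr _ _) _.
exact: leq_trans (size_line _ _ _ _) szC.
Qed.

Let lev_TC i : lev 4 (T C)`_i.
Proof.
apply: (@lev_coef _ _ _ _ L_cost kap_gt0 _ _ s_gt0 1 1) => [|a].
  by rewrite expn1; apply: leq_trans (size_line _ _ _ _) (leqW szC).
rewrite horner_line.
apply: (lev_affine L_cost kap_gt0 s_gt0 (v := fun j => beta j * a) (w := fun=> 1)) => // j.
by rewrite mpolyC1 mul1r mpolyCM addrC.
Qed.

Let lev_E i : lev 5 E`_i.
Proof.
rewrite coef_nderivn -scaler_nat; apply: (lev_scale L_cost) => //.
Qed.

Let lev_E' i : lev 6 E^`()`_i.
Proof. by rewrite coef_deriv -scaler_nat; apply: (lev_scale L_cost). Qed.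

(** Level 6 bounds the coefficients of [E] and of its derivative. A step adds 17 levels: 8 up to
    [y'], 4 more for the derivative at [y'], and 5 for the update of [z]. *)
Let newton_E a : root (U g) a ->
  exists y, [/\ lev (6 + 17 * t) y, vanishes (2 ^ t) E.[y] & y@_0%MM = a].
Proof.
move=> ra; apply: newton (root_E ra) (root_E' ra) t => [c|l y z y' le6l ly lz].
  exact: lev_const.
have mono i j f : (i <= j)%N -> lev i f -> lev j f by apply: lev_mono.
have lEy : lev (l + 4) E.[y].
  apply: (lev_horner L_cost) => // [|i]; first exact: leqW.
  by apply: mono (lev_E i); lia.
have ly' : lev (l + 8) y'.
  rewrite (_ : (l + 8 = l + 5 + 3)%N); last by lia.
  apply: (lev_sub L_cost) => //; first by apply: mono ly; lia.
  by rewrite addnS; apply: (lev_mul L_cost) => //; apply: mono lz; lia.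
have lEy' : lev (l + 12) E^`().[y'].
  rewrite (_ : (l + 12 = l + 8 + 4)%N); last by lia.
  apply: (lev_horner L_cost) => // [|i]; last by apply: mono (lev_E' i); lia.
  apply: leq_trans (size_poly _ _) _; apply: leq_trans (leq_pred _) _.
  exact: leqW.
split; first by apply: mono ly'; lia.
rewrite (_ : (l + 17 = (l + 16).+1)%N); last by lia.
apply: (lev_mul L_cost) => //; first by apply: mono lz; lia.
rewrite (_ : (l + 16 = l + 13 + 3)%N); last by lia.
apply: (lev_sub L_cost) => //; first by rewrite -mpolyC_nat; apply: lev_const.
rewrite (_ : (l + 13 = (l + 12).+1)%N); last by lia.
by apply: (lev_mul L_cost) => //; apply: mono lz; lia.
Qed.

(* The Newton iterates for E converge to the root of T g above a, which is
   only known to exist: uniqueness of the lift of a simple root of E. *)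
Let root_approx a : root (U g) a ->
  exists y, (lev (6 + 17 * t) y /\ vanishes (2 ^ t) (T g).[y]) /\ y@_0%MM = a.
Proof.
move=> ra; have [y [ly vy ya]] := newton_E ra.
have [w [_ vw wa]] : exists w, [/\ True, vanishes (2 ^ t) (T g).[w] & w@_0%MM = a].
  apply: (@newton _ _ (fun _ _ => True) 0 0 (T g) a) => //; rewrite map_T //.
  exact: simple.
exists y; split; last exact: ya.
split; first exact: ly.
have vEw : vanishes (2 ^ t) E.[w].
  have [c def_c] := @nderivn_approx_root _ (T g) (T R) w m m.-1 (eq_leq (prednK m_gt0)).
  by rewrite /E def_C rmorphM rmorphXn def_c; exact: (vanishesMr _ vw).
have vyw : vanishes (2 ^ t) (y - w).
  have [c] := taylor2 E w (y - w); rewrite addrC subrK => def_c.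
  (* The cofactor of [y - w] in [E.[y] - E.[w]]; at the origin it is the derivative at a simple
     root, hence nonzero. *)
  apply: (@vanishes_unit _ _ _ (E^`().[w] + c * (y - w))).
    rewrite mcoeffD (_ : (c * (y - w))@_0%MM = 0) ?addr0.
      by rewrite -(horner_map (mcoeff 0%MM)) -deriv_map /= wa; apply: root_E'.
    by apply/vanishes1P/vanishesMl/vanishes1P; rewrite mcoeffB ya wa subrr.
  have -> : (E^`().[w] + c * (y - w)) * (y - w) = E.[y] - E.[w].
    by rewrite def_c; ring.
  exact: (vanishesB vy vEw).
have [c] := taylor1 (T g) w (y - w); rewrite addrC subrK => ->.
exact: (vanishesD vw (vanishesMl _ vyw)).
Qed.

(** [g] is the value of [T g] at [y = 0], so it agrees with the leading coefficient times the
    product of the negated approximate roots up to order [2 ^ t], which exceeds its degree.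
    Truncation then recovers it exactly and doubles [17 * t] to [34 * t]. *)
Lemma lev_factor : lev (34 * t + 24) g.
Proof.
have [rs def_rs] := closed_field_poly_normal (U g).
have nzU : U g != 0 by rewrite -size_poly_gt0 sizeU lt0n msize_poly_eq0.
have nzl : lead_coef (U g) != 0 by rewrite lead_coef_eq0.
have size_rs : (size rs).+1 = msize g.
  by rewrite -sizeU def_rs size_scale // size_prod_XsubC.
have uniq_rs : uniq rs.
  (* Simple roots make [U g] separable, so its list of roots has no repetition. *)
  rewrite -separable_prod_XsubC -(eqp_separable (eqp_scale _ nzl)) -def_rs.
  rewrite unlock; apply: Pdiv.ClosedField.root_coprimep => a ra.
  exact: simple.
have [ys [def_ys ys_ok]] : exists ys : seq {mpoly K[n]},
    [seq y@_0%MM | y <- ys] = rs /\ (forall y, y \in ys ->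
      lev (6 + 17 * t) y /\ vanishes (2 ^ t) (T g).[y]).
  apply: lift_seq => a a_rs; apply: root_approx.
  by rewrite def_rs rootZ // root_prod_XsubC.
have size_ys : size ys = size rs by rewrite -def_ys size_map.
have size_T : size (T g) = (size ys).+1.
  apply/eqP; rewrite size_ys size_rs eqn_leq size_line /= -sizeU -map_T.
  exact: size_poly.
have [c def_c] : exists c, lead_coef (T g) = c%:MP.
  exists (lead_coef (T g))@_0%MM; apply: msize1_polyC; rewrite lead_coefE.
  apply: leq_trans (msize_coef_line _ _ _) _; rewrite size_T size_ys -size_rs /=.
  by rewrite subSnn.
have := @approx_factorization _ _ (2 ^ t) ys (T g) 0 size_T.
rewrite def_ys => /(_ uniq_rs (fun y ysy => proj2 (ys_ok y ysy))).
have -> : (T g).[0] = g.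
  rewrite horner_line -[RHS]mmap_idX; apply: mmap_ext => // j.
  by rewrite mulr0 addr0.
move/(vanishes_le lt_D)/(homogeneous_trunc szg) => ->.
rewrite (_ : (34 * t + 24 = 2 * (6 + 17 * t).+3 + 6)%N); last by lia.
apply: (lev_trunc L_cost) => //; apply: (lev_mul L_cost) => //.
  by rewrite def_c; apply: lev_const.
rewrite (big_nth 0) big_mkord; apply: (lev_prod L_cost) => // [|i].
  by move: szg; rewrite -size_rs -size_ys => lt_ys; apply: leqW (ltnW lt_ys).
rewrite sub0r; apply: (lev_opp L_cost) => //.
by have [] := ys_ok _ (mem_nth 0 (ltn_ord i)).
Qed.

End Stage.

(** * Inseparable multiplicities *)

Lemma msize_factor (K : fieldType) n (f g h : {mpoly K[n]}) :
  f = g * h -> f != 0 -> (msize g <= msize f)%N.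
Proof.
move=> -> /[!mulf_eq0] /norP[nzg nzh]; rewrite msizeM // (mpolySpred _ nzh) addnS.
exact: leq_addr.
Qed.

Lemma msize_prod_gt (K : fieldType) n (I : Type) (r : seq I)
    (F : I -> {mpoly K[n]}) :
  (forall i, 1 < msize (F i))%N -> (size r < msize (\prod_(i <- r) F i)%R)%N.
Proof.
move=> szF; elim: r => [|i r IH] /=; first by rewrite big_nil msize1.
have nzF j : F j != 0.
  by rewrite -msize_poly_eq0 -lt0n ltnW.
have nzP : \prod_(k <- r) F k != 0.
  by rewrite -msize_poly_eq0 -lt0n (leq_ltn_trans _ IH).
rewrite big_cons msizeM //; move: (szF i) IH.
by move: (msize (F i)) (msize (\prod_(k <- r) F k)) => x y; lia.
Qed.

Lemma msize_exp_gt (K : fieldType) n (f : {mpoly K[n]}) k :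
  (1 < msize f)%N -> (k < msize (f ^+ k)%R)%N.
Proof.
move=> szf; have := @msize_prod_gt _ _ _ (iota 0 k) (fun=> f) (fun=> szf).
by rewrite big_const_seq count_predT iter_mulr_1 size_iota.
Qed.

Lemma closed_field_pth_root (K : closedFieldType) q (x : K) :
  (0 < q)%N -> exists y, y ^+ q = x.
Proof.
move=> q_gt0; have /closed_rootP [y] : size ('X^q - x%:P) != 1%N.
  by rewrite size_XnsubC // eqSS -lt0n.
by rewrite rootE !hornerE subr_eq0 => /eqP; exists y.
Qed.

(** * Frobenius twists and the substitution of [q]-th powers of the variables *)

Section Twist.
Variables (p : nat) (K : closedFieldType) (charK : p \in [pchar K]) (n e : nat).
Implicit Types f g : {mpoly K[n]}.

Fixpoint frob (k : nat) : {rmorphism K -> K} :=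
  if k is l.+1 then pFrobenius_aut charK \o frob l else idfun.

Lemma frobE k x : frob k x = x ^+ (p ^ k).
Proof.
by elim: k => [|k IH] //=; rewrite pFrobenius_autE IH -exprM -expnSr.
Qed.

Let q_gt0 : (0 < p ^ e)%N.
Proof. by rewrite expn_gt0 prime_gt0 ?(pcharf_prime charK). Qed.

Lemma mpoly_exprD_pchar f g :
  (f + g) ^+ (p ^ e) = f ^+ (p ^ e) + g ^+ (p ^ e).
Proof.
have charM : p \in [pchar {mpoly K[n]}] by apply: rmorph_pchar (@mpolyC n K) _ charK.
by rewrite exprDn_pchar // pnatX pnatE ?(pcharf_prime charK) // charM.
Qed.

Definition power_subst : {mpoly K[n]} -> {mpoly K[n]} :=
  mmap (@mpolyC n K) (fun j => 'X_j ^+ (p ^ e)).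

HB.instance Definition _ := GRing.RMorphism.on power_subst.

Lemma power_substC c : power_subst c%:MP = c%:MP.
Proof. exact: mmapC. Qed.

Lemma power_substX j : power_subst 'X_j = 'X_j ^+ (p ^ e).
Proof. exact: mmapXU. Qed.

(** Raising to the power [q = p ^ e] raises coefficients and variables separately. *)
Lemma power_subst_twist f : power_subst (map_mpoly (frob e) f) = f ^+ (p ^ e).
Proof.
elim/mpoly_gen_ind: f => [c|j|f g IHf IHg|f g IHf IHg].
- by rewrite map_mpolyC power_substC -rmorphXn; congr _%:MP; apply: frobE.
- by rewrite map_mpolyX power_substX.
- by rewrite rmorphD rmorphD /= IHf IHg mpoly_exprD_pchar.
- by rewrite rmorphM rmorphM /= IHf IHg exprMn.
Qed.

Lemma msize_twist f : msize (map_mpoly (frob e) f) = msize f.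
Proof.
by rewrite !mmeasureE; apply/perm_big/msupp_map_mpoly; apply: fmorph_inj.
Qed.

(** Only affine substitutions need an argument: [v + w x^q = (v' + w' x)^q] for [q]-th roots [v']
    and [w'], so a substitution after [power_subst] is one before it. *)
Lemma twist_cost kap (L : {mpoly K[n]} -> nat -> Prop) :
  cost_measure kap L -> cost_measure kap (fun f s => L (power_subst f) s).
Proof.
move=> L_cost; split=> [f s t|c|N f s s_gt0 Lf|N f s s_gt0 Lf|v w f s s_gt0 Lf].
- by move=> le_st; apply: (cost_mono L_cost le_st).
- by rewrite power_substC; apply: (cost_const L_cost).
- by rewrite rmorph_sum; apply: (cost_sum L_cost).
- by rewrite rmorph_prod; apply: (cost_prod L_cost).
have /fin_all_exists [v' def_v] : forall j, exists y, y ^+ (p ^ e) = v j.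
  by move=> j; apply: closed_field_pth_root.
have /fin_all_exists [w' def_w] : forall j, exists y, y ^+ (p ^ e) = w j.
  by move=> j; apply: closed_field_pth_root.
have -> : power_subst (mmap (@mpolyC n K) (fun j => (v j)%:MP + (w j)%:MP * 'X_j) f) =
    mmap (@mpolyC n K) (fun j => (v' j)%:MP + (w' j)%:MP * 'X_j) (power_subst f).
  apply: (@mpoly_rmorph_ext _ _ _
    (power_subst \o mmap (@mpolyC n K) (fun j => (v j)%:MP + (w j)%:MP * 'X_j))
    (mmap (@mpolyC n K) (fun j => (v' j)%:MP + (w' j)%:MP * 'X_j) \o power_subst))
    => [c|j] /=.
    by rewrite mmapC !power_substC mmapC.
  rewrite mmapXU power_substX rmorphXn /= mmapXU mpoly_exprD_pchar exprMn.
  by rewrite -!rmorphXn /= def_v def_w rmorphD rmorphM /= !power_substC power_substX.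
exact: (cost_affine L_cost).
Qed.

(** Frobenius maps lines to lines, so the direction chosen once for the factors serves, after a
    twist, for the twisted factors of every stage. *)
Lemma line_twist (b : 'I_n -> K) f :
  line (idfun : {rmorphism K -> K}) (fun=> 0) (fun j => frob e (b j))
    (map_mpoly (frob e) f) =
  map_poly (frob e) (line (idfun : {rmorphism K -> K}) (fun=> 0) b f).
Proof.
apply: (@mpoly_rmorph_ext _ _ _
  (line (idfun : {rmorphism K -> K}) (fun=> 0) (fun j => frob e (b j)) \o
     map_mpoly (frob e))
  (map_poly (frob e) \o line (idfun : {rmorphism K -> K}) (fun=> 0) b)) => [c|j] /=.
  by rewrite map_mpolyC !lineC map_polyC.
rewrite map_mpolyX !lineX rmorphD rmorphM /= !map_polyC map_polyX /=.
by congr (_%:P + _); apply/esym/rmorph0.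
Qed.

Lemma root_twist (P : {poly K}) a : root (map_poly (frob e) P) a ->
  exists2 b, a = frob e b & root P b.
Proof.
have [b def_a] := closed_field_pth_root a q_gt0.
rewrite -{1}def_a -frobE fmorph_root => rb; exists b => //.
by rewrite frobE.
Qed.

End Twist.

Lemma horner0_line (K : fieldType) n (b : 'I_n -> K) (f : {mpoly K[n]}) :
  (line (idfun : {rmorphism K -> K}) (fun=> 0) b f).[0] = f@_0%MM.
Proof.
rewrite horner_line.
apply: (@mpoly_rmorph_ext _ _ _ (mmap _ _) (mcoeff 0%MM)) => [c|j] /=.
  by rewrite mmapC mcoeffC eqxx mulr1.
by rewrite mmapXU mulr0 addr0 mcoeffX mnm1_eq0.
Qed.

(** * One stage for each distinct exponent *)

Section MultiStage.
Variables (p : nat) (K : closedFieldType) (charK : p \in [pchar K]).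
Variables (n kap : nat) (L : {mpoly K[n]} -> nat -> Prop).
Hypotheses (L_cost : cost_measure kap L) (kap_gt0 : (0 < kap)%N).
Variables (D s t r : nat) (beta : 'I_n -> K) (u : K) (f : {mpoly K[n]}).
Variables (h : 'I_r -> {mpoly K[n]}) (e j : 'I_r -> nat).

Local Notation U g := (line (idfun : {rmorphism K -> K}) (fun=> 0) beta g).
Local Notation X := (kap * D.+3)%N.
Local Notation Q := (34 * t + 50)%N.

Hypotheses (s_gt0 : (0 < s)%N) (lt_D : (D < 2 ^ t)%N) (nzu : u != 0).
Hypothesis def_f : f = u%:MP * \prod_k h k ^+ (p ^ e k * j k).
Hypotheses (szf : (msize f <= D.+1)%N) (Lf : L f s).
Hypothesis szh : forall k, (1 < msize (h k))%N.
Hypothesis ndvd : forall k, ~~ (p %| j k)%N.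
Hypothesis sizeU : forall k, size (U (h k)) = msize (h k).
Hypothesis U0 : forall k, ~~ root (U (h k)) 0.
Hypothesis simple : forall k a, root (U (h k)) a -> ~~ root (U (h k))^`() a.
Hypothesis disjointU : forall i k a,
  k != i -> root (U (h i)) a -> ~~ root (U (h k)) a.

(** The rank of [x] among the distinct exponents, that is, the number of stages on which exponent
    [x] depends. *)
Definition values_below x := size (undup [seq y <- codom e | (y < x)%N]).

Lemma values_below_lt i x : (e i < x)%N -> (values_below (e i) < values_below x)%N.
Proof.
move=> lt_ix; pose s1 := undup [seq y <- codom e | (y < e i)%N].
have u1 : uniq (e i :: s1).
  by rewrite /= undup_uniq mem_undup mem_filter ltnn.
apply: (uniq_leq_size u1) => y; rewrite in_cons !mem_undup !mem_filter.
case/orP => [/eqP->|/andP[lty ->]]; first by rewrite lt_ix codom_f.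
by rewrite (ltn_trans lty).
Qed.

Lemma values_below_num i : (values_below (e i) < num_values e)%N.
Proof.
pose s1 := undup [seq y <- codom e | (y < e i)%N].
have u1 : uniq (e i :: s1).
  by rewrite /= undup_uniq mem_undup mem_filter ltnn.
apply: (uniq_leq_size u1) => y; rewrite in_cons !mem_undup mem_filter.
by case/orP => [/eqP->|/andP[_ ->//]]; rewrite codom_f.
Qed.

Let nzh k : h k != 0.
Proof. by rewrite -msize_poly_eq0 -lt0n ltnW. Qed.

Let j_gt0 k : (0 < j k)%N.
Proof. by case: (j k) (ndvd k) => //; rewrite dvdn0. Qed.

Let q_gt0 k : (0 < p ^ k)%N.
Proof. by rewrite expn_gt0 prime_gt0 ?(pcharf_prime charK). Qed.

Let nzprod (P : pred 'I_r) (N : 'I_r -> nat) : \prod_(k | P k) h k ^+ N k != 0.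
Proof. by apply/prodf_neq0 => k _; rewrite expf_neq0. Qed.

Let nzf : f != 0.
Proof. by rewrite def_f mulf_neq0 // mpolyC_eq0. Qed.

(** Every factor contributes at least 1 to the degree. The bound lets the product of factors count
    as a single level. *)
Lemma num_factors_leq : (r <= D.+2)%N.
Proof.
have szF k : (1 < msize (h k ^+ (p ^ e k * j k))%R)%N.
  apply: leq_trans (msize_exp_gt _ (szh k)).
  by rewrite ltnS muln_gt0 q_gt0 j_gt0.
have := msize_prod_gt (index_enum 'I_r) szF.
have -> : size (index_enum 'I_r) = r.
  by rewrite -[RHS]card_ord cardE enumT.
have le_f : (msize (\prod_k h k ^+ (p ^ e k * j k))%R <= msize f)%N.
  by rewrite def_f mul_mpolyC msizeZ.
move=> lt_r; apply: leqW; apply: ltnW.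
exact: leq_trans (leq_trans lt_r le_f) szf.
Qed.

Let le_power k : (msize (h k ^+ (p ^ e k * j k))%R <= D.+1)%N.
Proof.
apply: leq_trans szf; apply: (msize_factor _ nzf).
by rewrite def_f (bigD1 k) //= mulrCA.
Qed.

Let le_j k : (j k <= D.+2)%N.
Proof.
have := msize_exp_gt (p ^ e k * j k) (szh k) => lt_j.
have := leq_trans lt_j (le_power k); rewrite ltnS => le_D.
apply/leqW/leqW/leq_trans/le_D; exact: leq_pmull.
Qed.

(** The 50 extra levels of a stage are 2 for the product [A] of the known powers, 24 for dividing by
    it, and 24 in the extraction. *)
Lemma cost_factor_power i :
  L (h i ^+ (p ^ e i)) (X ^ (Q * (values_below (e i)).+1) * s).
Proof.
have [m] := ubnP (e i); elim: m i => // m IH i le_m.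
(* The bound for all lower exponents becomes the new unit of cost, so the powers already found have
   level 0. *)
pose S := (X ^ (Q * values_below (e i)) * s)%N.
have X_gt0 : (0 < X)%N by rewrite muln_gt0 kap_gt0.
have S_gt0 : (0 < S)%N by rewrite muln_gt0 expn_gt0 X_gt0.
have levI k : (e k < e i)%N -> lev kap L D S 0 (h k ^+ (p ^ e k)).
  move=> lt_ki; split; last first.
    rewrite expn1; apply: leqW; apply: leq_trans (le_power k).
    have nzhk : h k ^+ (p ^ e k * j k) != 0 by rewrite expf_neq0.
    apply: (msize_factor (h := h k ^+ (p ^ e k * (j k).-1)) _ nzhk).
    by rewrite -exprD -mulnS prednK.
  apply: (cost_mono L_cost _ (IH k _)); last by rewrite -ltnS (leq_trans _ le_m).
  rewrite mul1n leq_mul2r leq_pexp2l ?orbT // leq_mul2l.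
  by rewrite values_below_lt ?orbT.
pose A := \prod_(k | (e k < e i)%N) h k ^+ (p ^ e k * j k).
have levA : lev kap L D S 2 A.
  rewrite /A big_mkcond; apply: (lev_prod L_cost) => // [|k].
    exact: num_factors_leq.
  case: ifP => [lt_ki|_]; last by rewrite -mpolyC1; apply: lev_const.
  by rewrite exprM; apply: (lev_exp L_cost) => //; apply: levI.
(* All remaining exponents are divisible by [p ^ e i]; the unit [u] stays outside, so [C] below is
   [u] times the twist of [C0]. *)
pose C0 := h i ^+ j i * \prod_(k | (k != i) && (e i <= e k)%N) h k ^+ (p ^ (e k - e i) * j k).
pose B := u%:MP * C0 ^+ (p ^ e i).
have def_AB : f = A * B.
  rewrite def_f (bigID (fun k => (e k < e i)%N)) /= -/A mulrCA; congr (_ * (_ * _)).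
  rewrite (bigD1 i) ?ltnn //= /C0 exprMn -exprM mulnC; congr (_ * _).
  rewrite -prodrXl; apply: eq_big => [k|k]; first by rewrite -leqNgt andbC.
  by rewrite -leqNgt => /andP[le_ik _]; rewrite -exprM mulnAC -expnD subnK.
have szA : (msize A <= D.+1)%N.
  by apply: leq_trans szf; apply: msize_factor def_AB nzf.
have S2_gt0 : (0 < X ^ 2 * S)%N by rewrite muln_gt0 expn_gt0 X_gt0.
have [LB _] : lev kap L D (X ^ 2 * S) 24 B.
  (* Division needs a divisor nonzero at the origin, which holds because no factor has the root 0 on
     the line. *)
  apply: (lev_division L_cost kap_gt0 S2_gt0 def_AB nzf szf).
  - rewrite rmorph_prod /=; apply/prodf_neq0 => k _; rewrite rmorphXn expf_neq0 //=.
    by rewrite -(horner0_line beta); apply: U0.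
  - split; last by rewrite expn1; apply: leqW.
    apply: (cost_mono L_cost _ Lf); rewrite mul1n.
    by rewrite /S mulnA leq_pmull // muln_gt0 !expn_gt0 X_gt0.
  - by split; [rewrite mul1n; case: levA | rewrite expn1; apply: leqW].
pose S3 := (X ^ 24 * (X ^ 2 * S))%N.
have S3_gt0 : (0 < S3)%N by rewrite muln_gt0 expn_gt0 X_gt0.
pose tw := map_mpoly (frob charK (e i)) : {mpoly K[n]} -> {mpoly K[n]}.
pose R0 := \prod_(k | (k != i) && (e i <= e k)%N) h k ^+ (p ^ (e k - e i) * j k).
have nzC0 : C0 != 0 by rewrite mulf_neq0 ?expf_neq0.
have nzB : B != 0 by rewrite mulf_neq0 ?mpolyC_eq0 ?expf_neq0.
have szC0 : (msize C0 <= D.+1)%N.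
  apply: leq_trans szf; apply: (@leq_trans (msize B)); last first.
    by apply: (msize_factor (h := A) _ nzf); rewrite def_AB mulrC.
  apply: (msize_factor (h := u%:MP * C0 ^+ (p ^ e i).-1) _ nzB).
  by rewrite mulrCA -exprS prednK.
have szhi : (msize (h i) <= D.+1)%N.
  apply: leq_trans szC0; apply: (msize_factor (h := h i ^+ (j i).-1 * R0) _ nzC0).
  by rewrite mulrA -exprS prednK.
pose C := u%:MP * tw C0.
have pC : power_subst p (e i) C = B.
  by rewrite rmorphM /= power_substC power_subst_twist.
have root_tw g a : root (line (idfun : {rmorphism K -> K}) (fun=> 0)
    (fun l => frob charK (e i) (beta l)) (tw g)) a ->
    exists2 b, a = frob charK (e i) b & root (U g) b.
  by rewrite line_twist => /root_twist.
have [Lg _] : lev kap (fun g x => L (power_subst p (e i) g) x) D S3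
    (34 * t + 24) (tw (h i)).
  apply: (@lev_factor _ _ _ _ (twist_cost charK (e i) L_cost) kap_gt0 D S3 S3_gt0
    (fun l => frob charK (e i) (beta l)) C _ (u%:MP * tw R0) (j i)) => //.
  - by rewrite /C /C0 /tw rmorphM rmorphXn /= mulrCA.
  - by rewrite -(dvdn_pcharf charK).
  - by rewrite -msize_poly_eq0 msize_twist msize_poly_eq0.
  - by rewrite line_twist size_map_poly msize_twist.
  - move=> _ /root_tw [b -> rb].
    by rewrite line_twist deriv_map fmorph_root; apply: simple.
  - move=> _ /root_tw [b -> rb].
    rewrite rmorphM /= lineC line_twist rootM rootC (negPf nzu) fmorph_root /=.
    rewrite rmorph_prod rootE horner_prod; apply/prodf_neq0 => k /andP[neq_ki _].
    by rewrite rmorphXn horner_exp expf_neq0 //; apply: (disjointU neq_ki).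
  - by rewrite /C mul_mpolyC msizeZ // msize_twist.
  - by rewrite msize_twist.
  - split; first by rewrite pC mul1n.
    by rewrite /C mul_mpolyC msizeZ // msize_twist expn1; apply: leqW.
rewrite /tw power_subst_twist in Lg.
have expn4 x a b c d : (x ^ a * (x ^ b * (x ^ c * (x ^ d * s))) =
    x ^ (a + b + c + d) * s)%N by rewrite !mulnA -!expnD.
apply: (cost_mono L_cost _ Lg); rewrite /S3 /S expn4 leq_mul2r.
by apply/orP; right; rewrite leq_pexp2l // mulnS; lia.
Qed.

End MultiStage.

(** * Formulas and branching programs *)

(** Induction through the lists of children, which the nested inductive type calls for. *)
Lemma formula_nested_ind (R : Type) n (P : formula R n -> Prop) :
  (forall i, P (FVar R i)) -> (forall c, P (FConst n c)) ->
  (forall ts, foldr and True (map P ts) -> P (FAdd ts)) ->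
  (forall ts, foldr and True (map P ts) -> P (FMul ts)) -> forall t, P t.
Proof.
move=> PV PC PA PM; fix IH 1 => -[i|c|ts|ts].
- exact: PV.
- exact: PC.
- by apply: PA; elim: ts => //= t ts IHts; split.
- by apply: PM; elim: ts => //= t ts IHts; split.
Qed.

Section FormulaSubst.
Variables (R S : comNzRingType) (n : nat) (phi : {rmorphism R -> S}).
Variables (h : 'I_n -> formula S n) (d : nat).
Hypothesis size_h : forall i, (formula_size (h i) <= d)%N.

Fixpoint formula_subst (t : formula R n) : formula S n :=
  match t with
  | FVar i => h i
  | FConst c => FConst n (phi c)
  | FAdd ts => FAdd (map formula_subst ts)
  | FMul ts => FMul (map formula_subst ts)
  end.

Lemma formula_subst_eval t :
  formula_eval (formula_subst t) =
  mmap (@mpolyC n S \o phi) (fun i => formula_eval (h i)) (formula_eval t).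
Proof.
elim/formula_nested_ind: t => [i|c|ts|ts] /=.
- by rewrite mmapXU.
- by rewrite mmapC.
- by elim: ts => [|t ts IH] /= => [_|[-> /IH ->]]; rewrite ?rmorph0 ?rmorphD.
- by elim: ts => [|t ts IH] /= => [_|[-> /IH ->]]; rewrite ?rmorph1 ?rmorphM.
Qed.

Lemma formula_subst_size t :
  (formula_size (formula_subst t) <= d.+1 * formula_size t)%N.
Proof.
have key (x y z : nat) : (x <= d.+1 * z -> 1 + y + x <= d.+1 * (1 + y + z))%N by nia.
elim/formula_nested_ind: t => [i|c|ts|ts] /= => [||le_ts|le_ts].
- by rewrite muln1; apply: leqW.
- by rewrite muln1.
all: rewrite size_map; apply: key; elim: ts le_ts => [|t ts IH] //= [le_t /IH le_ts].
all: by rewrite mulnDr leq_add.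
Qed.

End FormulaSubst.

Lemma formula_map (F K : fieldType) n (iota : {rmorphism F -> K})
    (f : {mpoly F[n]}) s :
  formula_computable f s -> formula_computable (map_mpoly iota f) (2 * s).
Proof.
move=> [t [et st]]; exists (formula_subst iota (fun i => FVar K i) t).
rewrite formula_subst_eval et; split=> //.
apply: leq_trans (formula_subst_size iota (d := 1) _ t) _ => //.
by rewrite leq_mul2l st.
Qed.

Section FormulaCost.
Variables (K : closedFieldType) (n : nat).

Lemma formula_cost : cost_measure 16 (@formula_computable K n).
Proof.
split=> [f s t le_st [x [ex sx]]|c|N f s s_gt0 Lf|N f s s_gt0 Lf|v w f s s_gt0 [t [et st]]].
- by exists x; split=> //; apply: leq_trans le_st.
- by exists (FConst n c).
- have [ts Pts] := fin_all_exists Lf.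
  exists (FAdd [seq ts i | i <- enum 'I_N]); split=> /=.
    rewrite foldrE big_map big_map big_enum /=; apply: eq_bigr => i _.
    by case: (Pts i).
  rewrite size_map size_enum_ord sumnE big_map big_map big_enum /=.
  have : (\sum_i formula_size (ts i) <= N * s)%N.
    rewrite -[N in leqRHS]card_ord -sum_nat_const; apply: leq_sum => i _.
    by case: (Pts i).
  by move: (\sum_i _)%N => x; nia.
- have [ts Pts] := fin_all_exists Lf.
  exists (FMul [seq ts i | i <- enum 'I_N]); split=> /=.
    rewrite foldrE big_map big_map big_enum /=; apply: eq_bigr => i _.
    by case: (Pts i).
  rewrite size_map size_enum_ord sumnE big_map big_map big_enum /=.
  have : (\sum_i formula_size (ts i) <= N * s)%N.
    rewrite -[N in leqRHS]card_ord -sum_nat_const; apply: leq_sum => i _.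
    by case: (Pts i).
  by move: (\sum_i _)%N => x; nia.
(* This replacement for a variable has size 9, so the substitution multiplies the size by at most
   10. *)
pose h i := FAdd [:: FConst n (v i); FMul [:: FConst n (w i); FVar K i]].
exists (formula_subst idfun h t); rewrite formula_subst_eval et; split.
  by apply: mmap_ext => // i; rewrite /= addr0 mulr1.
apply: leq_trans (formula_subst_size idfun (d := 9) _ t) _ => //.
exact: leq_mul.
Qed.

End FormulaCost.

(** * Path sums of branching programs *)

Section AbpWeight.
Variables (R : comNzRingType) (n : nat).
Implicit Type B : abp R n.

(** Sum over walks of length [k] from [u] to the sink, unfolded along the first edge; it replaces
    sums over tuples by induction on [k]. *)
Fixpoint abp_weight B k (u : abp_vertex B) : {mpoly R[n]} :=
  if k is l.+1 then \sum_(v | abp_edge u v) abp_label u v * abp_weight l v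
  else (u == abp_sink B)%:R.

Lemma abp_weightE B k (u : abp_vertex B) :
  \sum_(q : k.-tuple (abp_vertex B) | path (@abp_edge _ _ B) u q
          && (last u q == abp_sink B))
    \prod_(a <- pairmap (@abp_label _ _ B) u q) a = abp_weight k u.
Proof.
elim: k u => [|k IH] u.
  rewrite /=; case eq_u: (u == abp_sink B).
    rewrite (big_pred1 [tuple]) => [|q]; first by rewrite big_nil.
    by rewrite [q]tuple0 /= eq_u !eqxx.
  by rewrite big_pred0 // => q; rewrite [q]tuple0 /= eq_u.
rewrite /= (reindex (fun x : abp_vertex B * k.-tuple (abp_vertex B) =>
   cons_tuple x.1 x.2)) /=; last first.
  exists (fun q : k.+1.-tuple (abp_vertex B) => (thead q, behead_tuple q)).
    by move=> [v q] _ /=; congr pair; apply: val_inj.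
  by move=> q _; rewrite [RHS]tuple_eta; apply: val_inj.
transitivity (\sum_(v | abp_edge u v) \sum_(q : k.-tuple (abp_vertex B) |
    path (@abp_edge _ _ B) v q && (last v q == abp_sink B))
    \prod_(a <- pairmap (@abp_label _ _ B) u (v :: q)) a).
  by rewrite pair_big_dep /=; apply: eq_bigl => -[v q] /=; rewrite andbA.
apply: eq_bigr => v _; rewrite -IH big_distrr /=; apply: eq_bigr => q _.
by rewrite big_cons.
Qed.

Lemma abp_evalE B : abp_eval B = abp_weight (abp_depth B) (abp_source B).
Proof. exact: abp_weightE. Qed.

Lemma abp_no_edge_sink B v : abp_edge (abp_sink B) v = false.
Proof.
have sinkB : abp_layer (abp_sink B) = abp_depth B by apply/abp_sinkP.
apply/negP => /(@abp_edge_layer _ _ B) layv; have := abp_layer_le v.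
by rewrite layv sinkB ltnn.
Qed.

Lemma abp_size_leq B (l : seq (abp_vertex B * abp_vertex B)) :
  (forall u v, abp_edge u v -> (u, v) \in l) -> (abp_size B <= size l)%N.
Proof.
move=> sub; rewrite /abp_size; apply: leq_trans (card_size l).
by apply/subset_leq_card/subsetP => -[u v]; rewrite inE => /sub.
Qed.

Definition abp_edges B := enum [set x : abp_vertex B * abp_vertex B | abp_edge x.1 x.2].

Lemma size_abp_edges B : size (abp_edges B) = abp_size B.
Proof. by rewrite /abp_edges -cardE. Qed.

Lemma mem_abp_edges B u v : ((u, v) \in abp_edges B) = abp_edge u v.
Proof. by rewrite mem_enum inE. Qed.

(** A nonzero value forces a source-sink path, which uses an edge out of every layer but the last. A
    program computing 0 may be deep without edges. *)
Lemma abp_depth_leq B : abp_eval B != 0 -> (abp_depth B <= abp_size B)%N.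
Proof.
pose E k := [set x : abp_vertex B * abp_vertex B |
  abp_edge x.1 x.2 && (k <= abp_layer x.1)%N].
have walk k (u : abp_vertex B) : abp_weight k u != 0 -> (k <= #|E (abp_layer u)|)%N.
  elim: k u => [|k IH] u //= nzw.
  have [v uv nzv] : exists2 v, abp_edge u v & abp_weight k v != 0.
    have [/existsP[v /andP[uv nzv]]|] :=
        boolP [exists v : abp_vertex B, abp_edge u v && (abp_weight k v != 0)].
      by exists v.
    rewrite negb_exists => /forallP none; case/eqP: nzw.
    apply: big1 => v uv; have := none v; rewrite uv negbK => /eqP->.
    by rewrite mulr0.
  apply: leq_ltn_trans (IH v nzv) _; apply/proper_card/properP; split.
    apply/subsetP => x; rewrite !inE (abp_edge_layer uv) => /andP[->].
    exact: ltnW.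
  by exists (u, v); rewrite !inE /= uv ?leqnn // (abp_edge_layer uv) ltnn andbF.
rewrite abp_evalE => /walk le_d; apply: leq_trans le_d _.
by apply/subset_leq_card/subsetP => x; rewrite !inE => /andP[].
Qed.

End AbpWeight.

(** * Gluing branching programs *)

Section AbpConstructions.
Variables (R : comNzRingType) (n : nat).
Implicit Type A B : abp R n.

Lemma abp_unit : exists B : abp R n,
  [/\ abp_depth B = 0%N, abp_eval B = 1 & abp_size B = 0%N].
Proof.
pose lab (u v : unit) : {mpoly R[n]} := 0.
have P1 (v : unit) : (0 <= 0)%N by [].
have P2 (v : unit) : 0%N = 0%N <-> v = tt by case: v.
have P3 (u v : unit) : false -> 0%N = 1%N by [].
have P4 (u v : unit) : false -> (msize (lab u v) <= 2)%N by [].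
exists (@Abp R n unit 0 (fun=> 0%N) tt tt (fun _ _ => false) lab P1 P2 P2 P3 P4).
split=> //; first by rewrite abp_evalE.
by apply: eq_card0 => x; rewrite inE.
Qed.

Lemma abp_edge1 (l : {mpoly R[n]}) : (msize l <= 2)%N ->
  exists B : abp R n, abp_eval B = l /\ (abp_size B <= 1)%N.
Proof.
move=> szl; pose lab (u v : bool) : {mpoly R[n]} := l.
have P1 (v : bool) : (v <= 1)%N by case: v.
have P2 (v : bool) : v = 0%N :> nat <-> v = false by case: v.
have P3 (v : bool) : v = 1%N :> nat <-> v = true by case: v.
have P4 (u v : bool) : ~~ u && v -> v = u.+1 :> nat by case: u; case: v.
have P5 (u v : bool) : ~~ u && v -> (msize (lab u v) <= 2)%N by [].
pose B := @Abp R n bool 1 nat_of_bool false true (fun u v => ~~ u && v) lab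
  P1 P2 P3 P4 P5.
exists B; split.
  by rewrite abp_evalE /= (big_pred1 true) /= ?mulr1 // => -[].
apply: (@abp_size_leq _ _ B [:: (false, true)]) => -[] [] //.
Qed.

Lemma abp_zero d : exists B : abp R n,
  [/\ abp_depth B = d.+1, abp_eval B = 0 & abp_size B = 0%N].
Proof.
pose lab (u v : bool) : {mpoly R[n]} := 0.
have P1 (v : bool) : (v * d.+1 <= d.+1)%N by case: v; rewrite ?mul1n.
have P2 (v : bool) : (v * d.+1)%N = 0%N <-> v = false by case: v.
have P3 (v : bool) : (v * d.+1)%N = d.+1 <-> v = true by case: v; rewrite ?mul1n.
have P4 (u v : bool) : false -> (v * d.+1 = (u * d.+1).+1)%N by [].
have P5 (u v : bool) : false -> (msize (lab u v) <= 2)%N by [].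
exists (@Abp R n bool d.+1 (fun v => v * d.+1)%N false true (fun _ _ => false) lab
  P1 P2 P3 P4 P5); split=> //.
  by rewrite abp_evalE /= big_pred0.
by apply: eq_card0 => x; rewrite inE.
Qed.

Section Series.
Variables A B : abp R n.

Let layer (x : abp_vertex A + abp_vertex B) : nat :=
  match x with
  | inl u => abp_layer u
  | inr v => (abp_layer v + (abp_depth A).+1)%N
  end.

Let edge (x y : abp_vertex A + abp_vertex B) :=
  match x, y with
  | inl u, inl v => abp_edge u v
  | inr u, inr v => abp_edge u v
  | inl u, inr v => (u == abp_sink A) && (v == abp_source B)
  | inr _, inl _ => false
  end.

Let label (x y : abp_vertex A + abp_vertex B) : {mpoly R[n]} :=
  match x, y with
  | inl u, inl v => abp_label u v
  | inr u, inr v => abp_label u v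
  | _, _ => 1
  end.

Lemma abp_series : exists C : abp R n, [/\
  abp_depth C = (abp_depth B + (abp_depth A).+1)%N,
  abp_eval C = abp_eval A * abp_eval B &
  (abp_size C <= abp_size A + abp_size B + 1)%N].
Proof.
have srcB : abp_layer (abp_source B) = 0%N by apply/abp_sourceP.
have sinkA : abp_layer (abp_sink A) = abp_depth A by apply/abp_sinkP.
have P1 x : (layer x <= abp_depth B + (abp_depth A).+1)%N.
  by case: x => v /=; have := abp_layer_le v; lia.
have P2 x : layer x = 0%N <-> x = inl (abp_source A).
  case: x => v /=; last by split=> //; lia.
  by rewrite abp_sourceP; split=> [->|[->]].
have P3 x : layer x = (abp_depth B + (abp_depth A).+1)%N <-> x = inr (abp_sink B).
  case: x => v /=; first by split=> //; have := abp_layer_le v; lia.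
  split=> [/addIn/abp_sinkP->//|[->]]; congr (_ + _)%N; exact/abp_sinkP.
have P4 x y : edge x y -> layer y = (layer x).+1.
  case: x y => u [] v //= => [/(@abp_edge_layer _ _ A)//| |].
    by case/andP => /eqP-> /eqP->; rewrite srcB sinkA.
  by move/(@abp_edge_layer _ _ B)->.
have P5 x y : edge x y -> (msize (label x y) <= 2)%N.
  by case: x y => u [] v //=; [exact: abp_label_affine | rewrite msize1 |
     exact: abp_label_affine].
pose C := @Abp R n (abp_vertex A + abp_vertex B)%type _ layer (inl (abp_source A))
  (inr (abp_sink B)) edge label P1 P2 P3 P4 P5.
exists C; split=> //; last first.
  pose l := [seq (inl x.1, inl x.2) | x <- abp_edges A] ++
    [seq (inr x.1, inr x.2) | x <- abp_edges B] ++
    [:: (inl (abp_sink A), inr (abp_source B))]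
    : seq (abp_vertex C * abp_vertex C).
  have -> : (abp_size A + abp_size B + 1 = size l)%N.
    by rewrite !size_cat !size_map !size_abp_edges addnA.
  apply: abp_size_leq => -[u|u] [v|v] //= uv; rewrite !mem_cat.
  - by apply/orP; left; apply/mapP; exists (u, v); rewrite ?mem_abp_edges.
  - by case/andP: uv => /eqP-> /eqP->; rewrite mem_head !orbT.
  - apply/orP; right; apply/orP; left.
    by apply/mapP; exists (u, v); rewrite ?mem_abp_edges.
have wB k v : @abp_weight _ _ C k (inr v) = abp_weight k v.
  elim: k v => [|k IH] v //=.
  rewrite big_sumType /= big_pred0 // add0r; apply: eq_bigr => w _.
  by rewrite IH.
have wA k u : (abp_layer u + k = abp_depth A)%N ->
    @abp_weight _ _ C (abp_depth B + k.+1) (inl u) = abp_weight k u * abp_eval B.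
  elim: k u => [|k IH] u.
    rewrite addn0 => /abp_sinkP-> /=; rewrite eqxx mul1r addn1 /= big_sumType /=.
    rewrite big_pred0 => [|v]; last exact: abp_no_edge_sink.
    rewrite add0r (big_pred1 (abp_source B)) => [|v]; last by rewrite eqxx.
    by rewrite mul1r wB abp_evalE.
  move=> lay; rewrite addnS /= big_sumType /= [X in _ + X]big_pred0 => [|v]; last first.
    apply/negP => /andP[/eqP eu _]; move: lay; rewrite eu sinkA; lia.
  rewrite addr0 big_distrl /=; apply: eq_bigr => v uv.
  by rewrite IH ?mulrA // (abp_edge_layer uv); lia.
rewrite abp_evalE wA ?abp_evalE //.
by rewrite (_ : abp_layer _ = 0%N) //; apply/abp_sourceP.
Qed.

End Series.

(* Attaching B inside the deeper program A keeps the depth of A, so that long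
   sums need no repeated padding. *)
Section Parallel.
Variables A B : abp R n.
Hypothesis depthAB : abp_depth A = (abp_depth B).+2.

Let layer (x : abp_vertex A + abp_vertex B) : nat :=
  match x with
  | inl u => abp_layer u
  | inr v => (abp_layer v).+1
  end.

Let edge (x y : abp_vertex A + abp_vertex B) :=
  match x, y with
  | inl u, inl v => abp_edge u v
  | inr u, inr v => abp_edge u v
  | inl u, inr v => (u == abp_source A) && (v == abp_source B)
  | inr u, inl v => (u == abp_sink B) && (v == abp_sink A)
  end.

Let label (x y : abp_vertex A + abp_vertex B) : {mpoly R[n]} :=
  match x, y with
  | inl u, inl v => abp_label u v
  | inr u, inr v => abp_label u v
  | _, _ => 1
  end.

Lemma abp_parallel : exists C : abp R n, [/\
  abp_depth C = abp_depth A,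
  abp_eval C = abp_eval A + abp_eval B &
  (abp_size C <= abp_size A + abp_size B + 2)%N].
Proof.
have srcA : abp_layer (abp_source A) = 0%N by apply/abp_sourceP.
have srcB : abp_layer (abp_source B) = 0%N by apply/abp_sourceP.
have sinkA : abp_layer (abp_sink A) = abp_depth A by apply/abp_sinkP.
have sinkB : abp_layer (abp_sink B) = abp_depth B by apply/abp_sinkP.
have P1 x : (layer x <= abp_depth A)%N.
  by case: x => v /=; have := abp_layer_le v; lia.
have P2 x : layer x = 0%N <-> x = inl (abp_source A).
  case: x => v /=; last by split.
  by rewrite abp_sourceP; split=> [->|[->]].
have P3 x : layer x = abp_depth A <-> x = inl (abp_sink A).
  case: x => v /=; last by split=> //; have := abp_layer_le v; lia.
  by rewrite abp_sinkP; split=> [->|[->]].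
have P4 x y : edge x y -> layer y = (layer x).+1.
  case: x y => u [] v //= => [/(@abp_edge_layer _ _ A)//| | |].
  - by case/andP => /eqP-> /eqP->; rewrite srcA srcB.
  - by case/andP => /eqP-> /eqP->; rewrite sinkA sinkB.
  - by move/(@abp_edge_layer _ _ B)->.
have P5 x y : edge x y -> (msize (label x y) <= 2)%N.
  by case: x y => u [] v //=; rewrite ?msize1 //; apply: abp_label_affine.
pose C := @Abp R n (abp_vertex A + abp_vertex B)%type _ layer (inl (abp_source A))
  (inl (abp_sink A)) edge label P1 P2 P3 P4 P5.
exists C; split=> //; last first.
  pose l := [seq (inl x.1, inl x.2) | x <- abp_edges A] ++
    [seq (inr x.1, inr x.2) | x <- abp_edges B] ++
    [:: (inl (abp_source A), inr (abp_source B)); (inr (abp_sink B), inl (abp_sink A))]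
    : seq (abp_vertex C * abp_vertex C).
  have -> : (abp_size A + abp_size B + 2 = size l)%N.
    by rewrite !size_cat !size_map !size_abp_edges addnA.
  apply: abp_size_leq => -[u|u] [v|v] //= uv; rewrite !mem_cat.
  - by apply/orP; left; apply/mapP; exists (u, v); rewrite ?mem_abp_edges.
  - by case/andP: uv => /eqP-> /eqP->; rewrite mem_head !orbT.
  - by case/andP: uv => /eqP-> /eqP->; rewrite !in_cons eqxx !orbT.
  - apply/orP; right; apply/orP; left.
    by apply/mapP; exists (u, v); rewrite ?mem_abp_edges.
have sink_neq : abp_sink A != abp_source A.
  by apply/eqP => eq_s; move: sinkA; rewrite eq_s srcA depthAB.
have wsink k : @abp_weight _ _ C k.+1 (inl (abp_sink A)) = 0.
  rewrite /= big_sumType /= !big_pred0 ?addr0 // => v.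
    by rewrite (negPf sink_neq).
  exact: abp_no_edge_sink.
(* A walk that leaves [B] early ends at the sink of [A], which has no outgoing edge; only an exit at
   the last step contributes. *)
have wB k v : @abp_weight _ _ C k.+1 (inr v) = abp_weight k v.
  elim: k v => [|k IH] v.
    rewrite /= big_sumType /= [X in _ + X]big1 => [|w _]; last by rewrite mulr0.
    rewrite addr0; case: eqP => [_|_] /=; last by rewrite big_pred0.
    rewrite (big_pred1 (abp_sink A)) => [|w]; last by rewrite /= ?eqxx.
    by rewrite /= eqxx mulr1.
  rewrite [LHS]/= big_sumType /= big1 => [|w /andP[_ /eqP->]]; last first.
    by rewrite mul1r; apply: wsink.
  rewrite add0r; apply: eq_bigr => w _.
  by congr (_ * _); apply: IH.
have wA k u : u != abp_source A -> @abp_weight _ _ C k (inl u) = abp_weight k u.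
  elim: k u => [|k IH] u neq_u //=.
  rewrite big_sumType /= [X in _ + X]big_pred0 => [|v]; last by rewrite (negPf neq_u).
  rewrite addr0; apply: eq_bigr => v uv; rewrite IH //.
  by apply/eqP => eq_v; have := abp_edge_layer uv; rewrite eq_v srcA.
rewrite !abp_evalE /= depthAB /= big_sumType /=; congr (_ + _).
  apply: eq_bigr => v uv; congr (_ * _); apply: (wA (abp_depth B).+1).
  by apply/eqP => eq_v; have := abp_edge_layer uv; rewrite eq_v srcA.
rewrite (big_pred1 (abp_source B)) => [|v]; last by rewrite eqxx.
by rewrite mul1r; apply: wB.
Qed.

End Parallel.

Lemma abp_pad B d : (abp_depth B <= d)%N -> exists C : abp R n, [/\
  abp_depth C = d, abp_eval C = abp_eval B &
  (abp_size C <= abp_size B + (d - abp_depth B))%N].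
Proof.
move=> /subnK; move: (d - abp_depth B)%N => k <-; elim: k => [|k [C [dC eC sC]]].
  by exists B; rewrite addn0.
have [E [dE eE sE]] := abp_unit; have [C' [dC' eC' sC']] := abp_series C E.
exists C'; rewrite dC' dE dC add0n addSn eC' eE mulr1 eC; split=> //.
move: sC' sC; rewrite sE; lia.
Qed.

End AbpConstructions.

Lemma abp_map (R S : comNzRingType) n
    (phi : {rmorphism {mpoly R[n]} -> {mpoly S[n]}}) (B : abp R n) :
  (forall l, msize l <= 2 -> msize (phi l) <= 2)%N ->
  exists C : abp S n, abp_eval C = phi (abp_eval B) /\ abp_size C = abp_size B.
Proof.
move=> phi_affine.
have P5 u v : @abp_edge _ _ B u v -> (msize (phi (abp_label u v)) <= 2)%N.
  by move=> uv; apply/phi_affine/abp_label_affine.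
pose C := @Abp S n (abp_vertex B) _ (@abp_layer _ _ B) (abp_source B) (abp_sink B)
  (@abp_edge _ _ B) (fun u v => phi (abp_label u v)) (@abp_layer_le _ _ B)
  (@abp_sourceP _ _ B) (@abp_sinkP _ _ B) (@abp_edge_layer _ _ B) P5.
exists C; split=> //; rewrite !abp_evalE /=.
have w k u : @abp_weight _ _ C k u = phi (@abp_weight _ _ B k u).
  elim: k u => [|k IH] u /=; first by rewrite rmorph_nat.
  by rewrite rmorph_sum; apply: eq_bigr => v _; rewrite rmorphM IH.
exact: w.
Qed.


Lemma abp_cost (K : closedFieldType) n : cost_measure 16 (@abp_computable K n).
Proof.
split=> [f s t le_st [x [ex sx]]|c|N f s s_gt0 Lf|N f s s_gt0 Lf|v w f s s_gt0 [B [eB sB]]].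
- by exists x; split=> //; apply: leq_trans le_st.
- by apply: abp_edge1; rewrite msizeC (leq_trans (leq_b1 _)).
(* All summands get the same depth [s]. A zero summand is replaced by an edgeless program, since its
   size does not bound its depth. *)
- have norm i : exists B : abp K n,
      [/\ abp_depth B = s, abp_eval B = f i & (abp_size B <= 2 * s)%N].
    have [B [eB sB]] := Lf i; have [f0|nzf] := eqVneq (f i) 0.
      have [Z [dZ eZ sZ]] := abp_zero K n s.-1.
      by exists Z; rewrite dZ eZ sZ f0 prednK.
    have dB : (abp_depth B <= s)%N.
      by apply: leq_trans sB; apply: abp_depth_leq; rewrite eB.
    have [C [dC eC sC]] := abp_pad dB; exists C; rewrite eC; split=> //.
    by move: sC sB; lia.
  have [C [_ eC sC]] : exists C : abp K n, [/\ abp_depth C = s.+2,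
      abp_eval C = \sum_i f i & (abp_size C <= N * (2 * s + 2))%N].
    elim: N f norm {Lf} => [|N IH] f norm.
      (* The sum starts from an edgeless program of depth [s.+2], inside which each summand of depth
         [s] fits with two connecting edges. *)
      by have [Z [dZ eZ sZ]] := abp_zero K n s.+1; exists Z; rewrite big_ord0 sZ.
    have [A [dA eA sA]] := IH _ (fun i => norm (widen_ord (leqnSn N) i)).
    have [B [dB eB sB]] := norm ord_max.
    have [|C [dC eC sC]] := @abp_parallel _ _ A B; first by rewrite dA dB.
    exists C; rewrite dC dA eC eA eB big_ord_recr; split=> //.
    by move: sC sA sB; nia.
  by exists C; split=> //; move: sC; nia.
- have [C [eC sC]] : exists C : abp K n,
      abp_eval C = \prod_i f i /\ (abp_size C <= N * (s + 1))%N.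
    elim: N f Lf => [|N IH] f Lf.
      by have [Z [dZ eZ sZ]] := abp_unit K n; exists Z; rewrite big_ord0 sZ.
    have [A [eA sA]] := IH _ (fun i => Lf (widen_ord (leqnSn N) i)).
    have [B [eB sB]] := Lf ord_max; have [C [_ eC sC]] := abp_series A B.
    exists C; rewrite eC eA eB big_ord_recr; split=> //.
    by move: sC sA sB; nia.
  by exists C; split=> //; move: sC; nia.
have [l szl|C [eC sC]] :=
    @abp_map K K n (mmap (@mpolyC n K) (fun j => (v j)%:MP + (w j)%:MP * 'X_j)) B.
  apply: leq_trans (msize_subst_affine _ _) szl => j.
  apply: leq_trans (msizeD_le _ _) _; rewrite geq_max msizeC mul_mpolyC.
  rewrite (leq_trans (leq_b1 _)) // (leq_trans (msizeZ_le _ _)) //.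
  by rewrite msizeX mdeg1.
by exists C; rewrite eC eB sC; split=> //; apply: leq_trans sB _; apply: leq_pmull.
Qed.

(** * Size bounds *)

Lemma abp_map_field (F K : fieldType) n (iota : {rmorphism F -> K})
    (f : {mpoly F[n]}) s :
  abp_computable f s -> abp_computable (map_mpoly iota f) s.
Proof.
move=> [B [eB sB]]; have [l szl|C [eC sC]] := abp_map (phi := map_mpoly iota) B.
  apply: leq_trans szl; rewrite !mmeasureE.
  by rewrite (perm_big _ (msupp_map_mpoly _ (fmorph_inj iota))).
by exists C; rewrite eC eB sC.
Qed.

(** * Recentring at a generic point and returning *)

Section FactorCost.
Variables (p : nat) (F : fieldType) (charF : p \in [pchar F]).
Variables (K : closedFieldType) (phi : {rmorphism 'F_p -> K}).
Hypothesis closureK : prime_field_closure phi.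
Variable iota : {rmorphism F -> K}.
Variables (n kap : nat) (L : {mpoly K[n]} -> nat -> Prop).
Hypotheses (L_cost : cost_measure kap L) (kap_gt0 : (0 < kap)%N).

Let shift (a : 'I_n -> K) : {mpoly K[n]} -> {mpoly K[n]} :=
  mmap (@mpolyC n K) (fun j => (a j)%:MP + 1%:MP * 'X_j).

Let cost_shift a f s : (0 < s)%N -> L f s -> L (shift a f) (kap * s)%N.
Proof. exact: (cost_affine L_cost a (fun=> 1)). Qed.

Let shiftK a f : shift (fun j => - a j) (shift a f) = f.
Proof.
apply: (@mpoly_rmorph_ext _ _ _
  (mmap (@mpolyC n K) (fun j => (- a j)%:MP + 1%:MP * 'X_j) \o
   mmap (@mpolyC n K) (fun j => (a j)%:MP + 1%:MP * 'X_j)) idfun) => [c|j] /=.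
  by rewrite !mmapC.
rewrite mmapXU rmorphD rmorphM /= !mmapC mmapXU mpolyC1 !mul1r addrA -mpolyCD.
by rewrite subrr mpolyC0 add0r.
Qed.

Let msize_shift a f : (msize (shift a f) <= msize f)%N.
Proof.
apply: msize_subst_affine => j; apply: leq_trans (msizeD_le _ _) _.
by rewrite geq_max msizeC mpolyC1 mul1r msizeX mdeg1 (leq_trans (leq_b1 _)).
Qed.

Let msize_map f : msize (map_mpoly iota f : {mpoly K[n]}) = msize f.
Proof. by rewrite !mmeasureE; apply/perm_big/msupp_map_mpoly/fmorph_inj. Qed.

Let line_shift a b f :
  line (idfun : {rmorphism K -> K}) (fun=> 0) b (shift a (map_mpoly iota f)) =
  line iota a b f.
Proof.
apply: (@mpoly_rmorph_ext _ _ _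
  (line (idfun : {rmorphism K -> K}) (fun=> 0) b \o
   mmap (@mpolyC n K) (fun j => (a j)%:MP + 1%:MP * 'X_j) \o map_mpoly iota)
  (line iota a b)) => [c|j] /=.
  by rewrite map_mpolyC mmapC !lineC.
rewrite map_mpolyX mmapXU rmorphD rmorphM /= !lineC !lineX.
by rewrite polyC0 add0r polyC1 mul1r.
Qed.

Lemma cost_irreducible_power (D s t r : nat) (f : {mpoly F[n]})
    (fs : 'I_r -> {mpoly F[n]}) (e j : 'I_r -> nat) (i : 'I_r) :
  ((msize f).-1 <= D)%N -> (0 < s)%N -> (D < 2 ^ t)%N ->
  L (map_mpoly iota f) s -> irreducible_factorization p f fs e j ->
  (num_values e <= D.+2)%N /\
  L (map_mpoly iota (fs i ^+ (p ^ e i)))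
    (kap * ((kap * D.+3) ^ ((34 * t + 50) * num_values e) * (kap * s)))%N.
Proof.
move=> szf s_gt0 lt_D Lf [irr nassoc ndvd [u nzu def_f]].
have charK := rmorph_pchar iota charF.
have sep k : exists l, (fs k)^`M(l) != 0.
  apply: irreducible_mderiv charF _ (irr k) => x.
  exact: algebraic_pth_root iota x charF closureK.
have [a [b lineP]] := generic_line iota irr nassoc sep.
(* Moving the base point to the origin makes the generic line pass through it; the inverse
   translation is applied to the result, each costing a factor [kap]. *)
pose h k := shift a (map_mpoly iota (fs k)).
have kaps_gt0 : (0 < kap * s)%N by rewrite muln_gt0 kap_gt0.
have def_g : shift a (map_mpoly iota f) =
    (iota u)%:MP * \prod_k h k ^+ (p ^ e k * j k).
  rewrite def_f rmorphM /= map_mpolyC /shift rmorphM /= mmapC; congr (_ * _).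
  by rewrite !rmorph_prod; apply: eq_bigr => k _; rewrite !rmorphXn.
have nzu' : iota u != 0 by rewrite fmorph_eq0.
have szg : (msize (shift a (map_mpoly iota f)) <= D.+1)%N.
  apply: leq_trans (msize_shift _ _) _; rewrite msize_map.
  by apply: leq_trans (leqSpred _) _.
have size_U k : size (line (idfun : {rmorphism K -> K}) (fun=> 0) b (h k)) = msize (h k).
  apply/eqP; rewrite eqn_leq size_line line_shift /=.
  have [-> _ _ _] := lineP k; apply: leq_trans (msize_shift _ _) _.
  by rewrite msize_map.
have szh k : (1 < msize (h k))%N.
  rewrite -size_U line_shift; have [-> _ _ _] := lineP k.
  exact: irreducible_msize.
have U0 k : ~~ root (line (idfun : {rmorphism K -> K}) (fun=> 0) b (h k)) 0.
  by rewrite line_shift; have [] := lineP k.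
have simple k z : root (line (idfun : {rmorphism K -> K}) (fun=> 0) b (h k)) z ->
    ~~ root (line (idfun : {rmorphism K -> K}) (fun=> 0) b (h k))^`() z.
  by rewrite line_shift; have [_ _ + _] := lineP k; apply.
have disj k l z : l != k ->
    root (line (idfun : {rmorphism K -> K}) (fun=> 0) b (h k)) z ->
    ~~ root (line (idfun : {rmorphism K -> K}) (fun=> 0) b (h l)) z.
  by rewrite !line_shift; have [_ _ _] := lineP k; apply.
split.
  apply: leq_trans (num_factors_leq charK nzu' def_g szg szh ndvd).
  by apply: leq_trans (size_undup _) _; rewrite size_codom card_ord.
have Lh := cost_factor_power charK L_cost kap_gt0 kaps_gt0 lt_D nzu' def_g szg
  (cost_shift a s_gt0 Lf) szh ndvd size_U U0 simple disj i.
rewrite rmorphXn /= -(shiftK a (map_mpoly iota (fs i) ^+ (p ^ e i))).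
have X_gt0 : (0 < kap * D.+3)%N by rewrite muln_gt0 kap_gt0.
apply: cost_shift; first by rewrite muln_gt0 expn_gt0 X_gt0.
rewrite /shift rmorphXn /=; apply: (cost_mono L_cost _ Lh).
rewrite leq_mul2r; apply/orP; right; rewrite leq_pexp2l // leq_mul2l.
by rewrite values_below_num orbT.
Qed.

End FactorCost.

(** For [n >= 2] both [16 * D.+3] and [2 ^ up_log 2 D.+1] are bounded by fixed powers of [n] and of
    [2 ^ log2n n], so all exponents are multiples of [lam * log2n n]. For [n <= 1] the target
    degenerates to the constant [c]; there [lam] and [D] are bounded in terms of [a] alone. *)
Lemma cost_bound (a b : nat) : exists c, forall n lam,
  (0 < lam)%N -> (lam <= (a * n ^ a).+2)%N ->
  (16 * ((16 * (a * n ^ a).+3) ^ ((34 * up_log 2 (a * n ^ a).+1 + 50) * lam)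
     * (16 * (2 * (b.+1 * n ^ (b * log2n n))))) <=
   c * (n ^ (lam * log2n n)) ^ c)%N.
Proof.
have rearrange (x y z : nat) :
    (16 * (x * (16 * (2 * (z * y)))) = 512 * z * (x * y))%N by lia.
pose c0 := (16 * ((16 * a.+3) ^ ((34 * up_log 2 a.+1 + 50) * a.+2)
     * (16 * (2 * b.+1))))%N.
pose k1 := (16 * a.+3 + a)%N.
pose k2 := (34 * k1 + 50)%N.
pose c1 := (512 * b.+1)%N.
exists (c0 + c1 + (k1 * k2 + b))%N => n lam lam_gt0 le_lam.
set c := (c0 + c1 + (k1 * k2 + b))%N.
have [le_n1|gt_n1] := leqP n 1.
  have log0 : log2n n = 0%N by case: n le_n1 {le_lam} => [|[]].
  rewrite log0 !muln0 expn0 exp1n !muln1.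
  have leD : (a * n ^ a <= a)%N.
    rewrite -[leqRHS]muln1 leq_mul2l; apply/orP; right.
    by rewrite -[leqRHS](exp1n a); case: (a) => // k; rewrite leq_exp2r.
  have : (c0 <= c)%N by rewrite /c -addnA leq_addr.
  apply: leq_trans; rewrite /c0 leq_mul2l leq_mul2r; apply/orP; right; apply/orP; right.
  apply: (@leq_trans ((16 * a.+3) ^ ((34 * up_log 2 (a * n ^ a).+1 + 50) * lam))).
    by rewrite leq_exp2r ?muln_gt0 ?addn_gt0 ?orbT // leq_mul2l !ltnS leD.
  rewrite leq_pexp2l // leq_mul ?(leq_trans le_lam) // leq_add2r leq_mul2l.
  by rewrite leq_up_log.
set l := log2n n; set D := (a * n ^ a)%N.
have l_gt0 : (0 < l)%N by rewrite up_log_gt0.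
have n_gt0 : (0 < n)%N by apply: ltnW.
have leX : (16 * D.+3 <= n ^ k1)%N.
  apply: (@leq_trans (16 * a.+3 * n ^ a)).
    rewrite -mulnA leq_mul2l /=; have : (0 < n ^ a)%N by rewrite expn_gt0 n_gt0.
    by rewrite /D; move: (n ^ a)%N => x; nia.
  rewrite /k1 expnD leq_mul2r; apply/orP; right.
  apply: leq_trans (ltnW (ltn_expl _ (ltnSn 1))) _.
  by rewrite leq_exp2r.
have let_ : (up_log 2 D.+1 <= l * k1)%N.
  apply: up_log_min => //; apply: (@leq_trans (16 * D.+3)); first by lia.
  apply: leq_trans leX _; rewrite expnM leq_exp2r //.
  exact: up_logP.
have leQ : ((34 * up_log 2 D.+1 + 50) * lam <= k2 * (lam * l))%N.
  by rewrite /k2; move: let_ l_gt0; move: (up_log _ _) => t; nia.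
have leXQ : ((16 * D.+3) ^ ((34 * up_log 2 D.+1 + 50) * lam) <=
    (n ^ (lam * l)) ^ (k1 * k2))%N.
  apply: (@leq_trans ((n ^ k1) ^ (k2 * (lam * l)))).
    apply: (@leq_trans ((n ^ k1) ^ ((34 * up_log 2 D.+1 + 50) * lam))).
      by rewrite leq_exp2r ?muln_gt0 ?addn_gt0 ?orbT.
    by rewrite leq_pexp2l // expn_gt0 n_gt0.
  by rewrite -!expnM leq_pexp2l //; lia.
have leb : (n ^ (b * l) <= (n ^ (lam * l)) ^ b)%N.
  by rewrite -expnM leq_pexp2l // mulnC leq_mul2r leq_pmull ?orbT.
apply: (@leq_trans (c1 * ((n ^ (lam * l)) ^ (k1 * k2) * (n ^ (lam * l)) ^ b))).
  rewrite (rearrange (_ ^ ((34 * _ + 50) * _))%N (n ^ _)%N b.+1) leq_mul2l.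
  by rewrite leq_mul ?orbT.
rewrite -expnD leq_mul //; first by rewrite /c addnAC leq_addl.
by rewrite leq_pexp2l ?expn_gt0 ?n_gt0 // /c leq_addl.
Qed.

Theorem theorem5p5 (p : nat) (p_prime : prime p)
    (F : fieldType) (charF : p \in [pchar F])
    (K : closedFieldType) (phi : {rmorphism 'F_p -> K})
    (closureK : prime_field_closure phi)
    (iota : {rmorphism F -> K})
    (a b : nat) :
  (exists c : nat,
    forall (n : nat) (f : {mpoly F[n]})
           (r : nat) (fs : 'I_r -> {mpoly F[n]}) (e j : 'I_r -> nat),
      ((msize f).-1 <= a * n ^ a)%N ->
      formula_computable f (b * n ^ (b * log2n n)) ->
      irreducible_factorization p f fs e j ->
      forall i : 'I_r,
        formula_computable (map_mpoly iota (fs i ^+ (p ^ e i)))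
          (c * (n ^ (num_values e * log2n n)) ^ c))
  /\
  (exists c : nat,
    forall (n : nat) (f : {mpoly F[n]})
           (r : nat) (fs : 'I_r -> {mpoly F[n]}) (e j : 'I_r -> nat),
      ((msize f).-1 <= a * n ^ a)%N ->
      abp_computable f (b * n ^ (b * log2n n)) ->
      irreducible_factorization p f fs e j ->
      forall i : 'I_r,
        abp_computable (map_mpoly iota (fs i ^+ (p ^ e i)))
          (c * (n ^ (num_values e * log2n n)) ^ c)).
Proof.
have [c cP] := cost_bound a b.
have main n (L : {mpoly K[n]} -> nat -> Prop) (L_cost : cost_measure 16 L)
    (f : {mpoly F[n]}) r (fs : 'I_r -> {mpoly F[n]}) (e j : 'I_r -> nat) :
    ((msize f).-1 <= a * n ^ a)%N ->
    L (map_mpoly iota f) (2 * (b * n ^ (b * log2n n)))%N ->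
    irreducible_factorization p f fs e j -> forall i,
    L (map_mpoly iota (fs i ^+ (p ^ e i)))
      (c * (n ^ (num_values e * log2n n)) ^ c)%N.
  move=> szf Lf fact i; set D := (a * n ^ a)%N in szf.
  have lt_D : (D < 2 ^ up_log 2 D.+1)%N by exact: up_logP.
  (* [b.+1] in place of [b] keeps the base cost positive when [b = 0]; for [n = 0] the exponent is
     0. *)
  have s_gt0 : (0 < 2 * (b.+1 * n ^ (b * log2n n)))%N.
    rewrite !muln_gt0 expn_gt0; have [->|//] := posnP n.
    by rewrite (_ : log2n 0 = 0%N) ?muln0.
  have Lf' : L (map_mpoly iota f) (2 * (b.+1 * n ^ (b * log2n n)))%N.
    by apply: (cost_mono L_cost _ Lf); rewrite leq_mul2l leq_mul2r leqnSn orbT.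
  have [le_lam Lh] := cost_irreducible_power charF closureK L_cost isT i szf s_gt0
    lt_D Lf' fact.
  apply: (cost_mono L_cost _ Lh); apply: cP le_lam.
  (* The index [i] witnesses that there is at least one exponent value. *)
  have : e i \in undup (codom e) by rewrite mem_undup codom_f.
  by rewrite /num_values; case: (undup _).
split; exists c => n f r fs e j szf Lf fact i.
  exact: (main n _ (formula_cost K n) f r fs e j szf (formula_map iota Lf) fact i).
apply: (main n _ (abp_cost K n) f r fs e j szf _ fact i).
apply: (cost_mono (abp_cost K n) _ (abp_map_field iota Lf)).
by rewrite leq_pmull.
Qed.
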